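(* Let $E$ be a Banach lattice not isomorphic to an AL-space and let $1<p<\infty$. Then $(\ell_p\widehat{\otimes}_{|\pi|}E)\setminus(\ell_p\widehat{\otimes}_{\pi}E)$ is completely latticeable in $\ell_p\widehat{\otimes}_{|\pi|}E$, where $\ell_p\widehat{\otimes}_{\pi}E$ is regarded as a linear subspace of $\ell_p\widehat{\otimes}_{|\pi|}E$ by means of the canonical injective bounded linear operator $A_L\colon\ell_p\widehat{\otimes}_{\pi}E\to\ell_p\widehat{\otimes}_{|\pi|}E$ with $A_L(t\otimes x)=t\otimes x$ for all $t\in\ell_p$ and $x\in E$.
   Context: Complete latticeability. A subset $A$ of a Banach lattice $X$ is completely latticeable (in $X$) if there is a closed infinite dimensional sublattice (Riesz subspace) of $X$ all of whose elements but the origin belong to $A$. An AL-space is a Banach lattice whose norm satisfies $\|x+y\|=\|x\|+\|y\|$ for all $x,y\geq0$. Tensor products. $\ell_p\widehat{\otimes}_{\pi}E$ is the completed projective tensor product of the Banach spaces $\ell_p$ and $E$. $\ell_p\widehat{\otimes}_{|\pi|}E$ is the (Fremlin) positive projective tensor product of the Banach lattices $\ell_p$ and $E$: the Banach lattice obtained by completing Fremlin's Riesz space tensor product $\ell_p\bar{\otimes}E$ (the Riesz space containing the algebraic tensor product $\ell_p\otimes E$, generated by it as a Riesz space, and universal for Riesz bimorphisms on $\ell_p\times E$ into Archimedean Riesz spaces) with respect to the positive projective norm $$\|u\|_{|\pi|}=\inf\Big\{\sum_{i=1}^n\|t_i\|\,\|x_i\|:\ n\in\mathbb{N},\ t_i\in\ell_p^+,\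 x_i\in E^+,\ |u|\le\sum_{i=1}^nt_i\otimes x_i\Big\}.$$ Identification. The continuous bilinear operator $A\colon\ell_p\times E\to\ell_p\widehat{\otimes}_{|\pi|}E$, $A(t,x)=t\otimes x$, has a linearization $A_L\colon\ell_p\widehat{\otimes}_{\pi}E\to\ell_p\widehat{\otimes}_{|\pi|}E$, which is bounded, linear and injective. As a vector space, $\ell_p\widehat{\otimes}_{\pi}E$ is identified with the linear subspace $A_L(\ell_p\widehat{\otimes}_{\pi}E)$ of $\ell_p\widehat{\otimes}_{|\pi|}E$. *)

(* Defs.v *)
From HB Require Import structures.
From mathcomp Require Import all_boot all_order all_algebra.
From mathcomp Require Import all_classical all_reals all_analysis.

Set Implicit Arguments.
Unset Strict Implicit.
Unset Printing Implicit Defensive.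

Import Order.TTheory GRing.Theory Num.Theory.
Import numFieldNormedType.Exports.

Local Open Scope classical_set_scope.
Local Open Scope ring_scope.

Reserved Notation "x <=r y" (at level 70, no associativity).

(* The order is carried by the mixin rather than inherited from Order.POrder:  *)
(* the hierarchy admits no structure joining Order.Preorder and                *)
(* Num.SemiNormedZmodule other than Num.NumDomain. Since x |-> - x reverses    *)
(* the order, binary suprema suffice (see rmeetP for infima).                  *)
HB.mixin Record Lmodule_isRiesz (R : realType) V of GRing.Lmodule R V := {
  rle : V -> V -> Prop ;
  rle_refl : forall x : V, rle x x ;
  rle_anti : forall x y : V, rle x y -> rle y x -> x = y ;
  rle_trans : forall y x z : V, rle x y -> rle y z -> rle x z ;
  rleD2r : forall z x y : V, rle x y -> rle (x + z) (y + z) ;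
  rscaler_ge0 : forall (a : R) (x : V), 0 <= a -> rle 0 x -> rle 0 (a *: x) ;
  rjoin : V -> V -> V ;
  rjoinP : forall x y z : V, rle (rjoin x y) z <-> rle x z /\ rle y z
}.

#[short(type="rieszType")]
HB.structure Definition Riesz (R : realType) :=
  { V of GRing.Lmodule R V & Lmodule_isRiesz R V }.

Notation "x <=r y" := (rle x y) : ring_scope.

Section riesz_ops.
Context (R : realType) (V : rieszType R).
Implicit Types x y z : V.

Definition rmeet x y : V := - rjoin (- x) (- y).

Definition modulus x : V := rjoin x (- x).

Lemma rleN2 x y : - x <=r - y <-> y <=r x.
Proof.
have imp (u v : V) : u <=r v -> - v <=r - u.
  move=> /(rleD2r (- u - v)).
  by rewrite addrA subrr add0r addrCA subrr addr0.
by split=> [/imp|/imp//]; rewrite !opprK.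
Qed.

Lemma rmeetP x y z : z <=r rmeet x y <-> z <=r x /\ z <=r y.
Proof. by rewrite /rmeet -{1}(opprK z) rleN2 rjoinP !rleN2. Qed.

End riesz_ops.

HB.mixin Record CompleteNormedModule_Riesz_isBanachLattice (R : realType) V
    of CompleteNormedModule R V & Riesz R V := {
  ler_norm_modulus : forall x y : V,
    modulus x <=r modulus y -> `|x| <= `|y| :> R
}.

#[short(type="banachLatticeType")]
HB.structure Definition BanachLattice (R : realType) :=
  { V of CompleteNormedModule R V & Riesz R V
       & CompleteNormedModule_Riesz_isBanachLattice R V }.

Section morphisms.
Context (R : realType).

Definition riesz_hom (V W : rieszType R) (f : V -> W) : Prop :=
  linear f /\ forall x y, f (rjoin x y) = rjoin (f x) (f y).

Definition is_bilinear (U V W : lmodType R) (b : U -> V -> W) : Prop :=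
  (forall v, linear (b ^~ v)) /\ (forall u, linear (b u)).

Definition riesz_bimorphism (U V W : rieszType R) (b : U -> V -> W) : Prop :=
  [/\ is_bilinear b,
      forall v, 0 <=r v -> riesz_hom (b ^~ v)
    & forall u, 0 <=r u -> riesz_hom (b u)].

Definition archimedean (V : rieszType R) : Prop :=
  forall x y : V, (forall n : nat, x *+ n <=r y) -> x <=r 0.

Definition lattice_isomorphic (E F : banachLatticeType R) : Prop :=
  exists (f : E -> F) (g : F -> E),
    [/\ riesz_hom f, cancel f g, cancel g f, continuous f & continuous g].

End morphisms.

Section subspaces.
Context (R : realType).

Definition linear_subspace (V : lmodType R) (S : set V) : Prop :=
  S 0 /\ forall (a : R) x y, S x -> S y -> S (a *: x + y).

Definition riesz_subspace (V : rieszType R) (S : set V) : Prop :=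
  linear_subspace S /\
  forall x y, S x -> S y -> S (rjoin x y) /\ S (rmeet x y).

Definition infinite_dimensional (V : lmodType R) (S : set V) : Prop :=
  ~ exists (n : nat) (e : 'I_n -> V),
      forall x, S x -> exists c : 'I_n -> R, x = \sum_i c i *: e i.

Definition completely_latticeable (X : banachLatticeType R) (A : set X) :=
  exists S : set X,
    [/\ riesz_subspace S, closed S, infinite_dimensional S
      & forall x, S x -> x != 0 -> A x].

Definition AL_space (X : banachLatticeType R) : Prop :=
  forall x y : X, 0 <=r x -> 0 <=r y -> `|x + y| = `|x| + `|y| :> R.

End subspaces.

Section tensor_products.
Context (R : realType).

(* Tensor products are not constructed but specified, up to isomorphism, by   *)
(* the predicates below: in each of them the type and the bilinear map (the    *)
(* map (u, v) |-> u (x) v) vary over all realizations of the tensor product.   *)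
Definition is_tensor_product (U V T : lmodType R) (t : U -> V -> T) : Prop :=
  is_bilinear t /\
  forall (W : lmodType R) (b : U -> V -> W), is_bilinear b ->
    exists f : T -> W,
      [/\ linear f, forall u v, f (t u v) = b u v
        & forall g : T -> W, linear g ->
            (forall u v, g (t u v) = b u v) -> g =1 f].

Definition projective_norm (X Y : normedModType R) (T : lmodType R)
    (t : X -> Y -> T) (u : T) : R :=
  inf [set r | exists (n : nat) (x : 'I_n -> X) (y : 'I_n -> Y),
    u = \sum_i t (x i) (y i) /\ r = \sum_i `|x i| * `|y i|].

(* Here j is the inclusion of the algebraic tensor product in its completion   *)
(* for the projective norm.                                                    *)
Definition is_projective_tensor (X Y : normedModType R)
    (P : completeNormedModType R) (tP : X -> Y -> P) : Prop :=
  exists (T : lmodType R) (t : X -> Y -> T) (j : T -> P),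
    [/\ is_tensor_product t, linear j /\ injective j,
        forall u, `|j u| = projective_norm t u,
        dense (range j)
      & forall x y, tP x y = j (t x y)].

(* The third clause says that G contains the algebraic tensor product, the     *)
(* fourth that it is generated by it as a Riesz space.                         *)
Definition is_fremlin_tensor (U V G : rieszType R) (t : U -> V -> G) : Prop :=
  [/\ archimedean G, riesz_bimorphism t,
      exists (T : lmodType R) (s : U -> V -> T) (i : T -> G),
        [/\ is_tensor_product s, linear i, injective i
          & forall u v, i (s u v) = t u v],
      forall S : set G, riesz_subspace S -> (forall u v, S (t u v)) ->
        S = [set: G]
    & forall (H : rieszType R) (b : U -> V -> H),
        archimedean H -> riesz_bimorphism b ->
        exists f : G -> H,
          [/\ riesz_hom f, forall u v, f (t u v) = b u v
            & forall g : G -> H, riesz_hom g ->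
                (forall u v, g (t u v) = b u v) -> g =1 f]].

Definition positive_projective_norm (X Y : banachLatticeType R)
    (G : rieszType R) (t : X -> Y -> G) (u : G) : R :=
  inf [set r | exists (n : nat) (x : 'I_n -> X) (y : 'I_n -> Y),
    [/\ forall i, 0 <=r x i, forall i, 0 <=r y i,
        modulus u <=r \sum_i t (x i) (y i)
      & r = \sum_i `|x i| * `|y i|]].

(* Here j is the inclusion of Fremlin's Riesz space tensor product in its      *)
(* completion for the positive projective norm.                                *)
Definition is_positive_projective_tensor (X Y : banachLatticeType R)
    (F : banachLatticeType R) (tF : X -> Y -> F) : Prop :=
  exists (G : rieszType R) (t : X -> Y -> G) (j : G -> F),
    [/\ is_fremlin_tensor t, riesz_hom j /\ injective j,
        forall u, `|j u| = positive_projective_norm t u,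
        dense (range j)
      & forall x y, tF x y = j (t x y)].

End tensor_products.

HB.lock Definition ell_sum (R : realType) (p : R) (x : nat -> R) : \bar R :=
  (\sum_(k <oo) (`|x k| `^ p)%:E)%E.

Section ell_sum.
Context (R : realType) (p : R).
Hypothesis p1 : 1 <= p.
Implicit Types x y : nat -> R.

Let p0 : 0 < p. Proof. exact: lt_le_trans p1. Qed.

Lemma ell_sum_ge0 x : (0 <= ell_sum p x)%E.
Proof. by rewrite ell_sum.unlock; apply: nneseries_ge0 => n _ _; rewrite lee_fin powR_ge0. Qed.

Lemma ell_sum_Lnorm x :
  Lnorm counting p%:E (EFin \o x) = (ell_sum p x `^ p^-1)%E.
Proof. by rewrite ell_sum.unlock Lnorm_counting. Qed.

Lemma le_ell_sum x y : (forall k, `|x k| <= `|y k|) ->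
  (ell_sum p x <= ell_sum p y)%E.
Proof.
rewrite ell_sum.unlock => xy; apply: lee_nneseries => [k _ _|k _]; first by rewrite lee_fin powR_ge0.
by rewrite lee_fin ge0_ler_powR ?nnegrE// ltW.
Qed.

Lemma ell_sum0 : ell_sum p (fun=> 0) = 0%E.
Proof. by rewrite ell_sum.unlock; apply: eseries0 => k _ _; rewrite normr0 powR0 ?gt_eqF. Qed.

Lemma ell_sumZ (a : R) x :
  ell_sum p (fun k => a * x k) = ((`|a| `^ p)%:E * ell_sum p x)%E.
Proof.
rewrite ell_sum.unlock -nneseriesZl; last by move=> k _; rewrite lee_fin powR_ge0.
by apply: eq_eseriesr => k _; rewrite /= normrM powRM// EFinM.
Qed.

Lemma ell_minkowski x y :
  (ell_sum p (x \+ y)%R `^ p^-1 <= ell_sum p x `^ p^-1 + ell_sum p y `^ p^-1)%E.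
Proof.
rewrite -!ell_sum_Lnorm.
apply: (@minkowski_EFin _ _ _ counting x y p) => //; exact: measurableT.
Qed.

End ell_sum.

Section ell_complete_aux.
Context (R : realType) (p : R).
Hypothesis p1 : 1 <= p.
Implicit Types x y : nat -> R.

Let p0 : 0 < p. Proof. exact: lt_le_trans p1. Qed.

Lemma continuous_norm_powR : continuous (fun a : R => `|a| `^ p).
Proof.
move=> a; have [->|a0] := eqVneq a 0; last first.
  apply: (@continuous_comp R R R (fun a : R => `|a|) (fun b : R => b `^ p)).
    exact: (@norm_continuous R R^o).
  apply: differentiable_continuous; apply/derivable1_diffP.
  by apply: derivable_powR; rewrite in_itv/= andbT normr_gt0.
apply/cvgrPdist_lt => e e0; near=> b.
rewrite normr0 powR0 ?gt_eqF// sub0r normrN ger0_norm ?powR_ge0//.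
have -> : e = (e `^ p^-1) `^ p by rewrite -powRrM mulVf ?gt_eqF// powRr1// ltW.
rewrite gt0_ltr_powR ?nnegrE ?powR_ge0//.
by near: b; apply: (@pseudometric_normed_Zmodule.nbhs0_lt R R); rewrite powR_gt0.
Unshelve. all: by end_near. Qed.

Lemma ell_sum_le_lim (T : Type) (F : set_system T) (FF : ProperFilter F)
    (u : T -> nat -> R) (x : nat -> R) (M : R) :
  (forall k, u ^~ k @ F --> x k) ->
  (\forall t \near F, ell_sum p (u t) <= M%:E)%E -> (ell_sum p x <= M%:E)%E.
Proof.
rewrite ell_sum.unlock => ux uM; apply: lime_le.
  by apply: is_cvg_nneseries => k _ _; rewrite lee_fin powR_ge0.
apply: nearW => n /=; rewrite sumEFin lee_fin.
have cu : (fun t => \sum_(0 <= k < n) `|u t k| `^ p) @ F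
    --> \sum_(0 <= k < n) `|x k| `^ p.
  elim: n => [|n IHn].
    by under eq_fun do rewrite big_nil; rewrite big_nil; exact: cvg_cst.
  under eq_fun do rewrite big_nat_recr//=; rewrite big_nat_recr//=.
  apply: cvgD => //.
  exact: (continuous_cvg _ (@continuous_norm_powR _) (ux n)).
apply: (closed_cvg (fun r : R => r <= M) (@closed_le R M) _ _ cu).
apply: filterS uM => t utM; rewrite -lee_fin (le_trans _ utM)// -sumEFin.
apply: nneseries_lim_ge => k _ _.
by rewrite lee_fin powR_ge0.
Qed.

End ell_complete_aux.

Definition ell_pred (R : realType) (p : R) of 1 <= p : {pred nat -> R} :=
  [pred x | (ell_sum p x < +oo)%E].

Record ell (R : realType) (p : R) (p1 : 1 <= p) := Ell {
  ell_seq :> nat -> R ;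
  _ : ell_seq \in ell_pred p1
}.

Section ell_lmodule.
Context (R : realType) (p : R) (p1 : 1 <= p).

Let p0 : 0 < p. Proof. exact: lt_le_trans p1. Qed.

HB.instance Definition _ := [isSub for @ell_seq R p p1].
HB.instance Definition _ := [Choice of ell p1 by <:].

Lemma ell_submod_closed : submod_closed (ell_pred p1).
Proof.
split=> [|a x y]; rewrite !inE; first by rewrite ell_sum0.
move=> xp yp.
have fin (z : nat -> R) : (ell_sum p z `^ p^-1 < +oo)%E = (ell_sum p z < +oo)%E.
  have := ell_sum_ge0 p z.
  case: (ell_sum p z) => [r r0|_|//]; first by rewrite poweR_EFin !ltry.
  by rewrite poweRyr ?invr_eq0 ?gt_eqF.
rewrite -fin (le_lt_trans (ell_minkowski p1 _ _))// lte_add_pinfty ?fin//.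
by rewrite ell_sumZ// lte_mul_pinfty ?lee_fin ?powR_ge0.
Qed.

HB.instance Definition _ :=
  GRing.isSubmodClosed.Build _ _ (ell_pred p1) ell_submod_closed.
HB.instance Definition _ := [SubChoice_isSubLmodule of ell p1 by <:].

End ell_lmodule.

HB.lock Definition ell_norm (R : realType) (p : R) (p1 : 1 <= p)
    (x : ell p1) : R := fine (ell_sum p x) `^ p^-1.

Section ell_normed.
Context (R : realType) (p : R) (p1 : 1 <= p).
Implicit Types x y z : ell p1.

Let p0 : 0 < p. Proof. exact: lt_le_trans p1. Qed.

Lemma ell_sum_fin x : ell_sum p x \is a fin_num.
Proof. by rewrite ge0_fin_numE ?ell_sum_ge0//; case: x. Qed.

Lemma ell_normE x : (ell_sum p x `^ p^-1)%E = (ell_norm x)%:E.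
Proof. by rewrite ell_norm.unlock -(fineK (ell_sum_fin x)) poweR_EFin. Qed.

Lemma ell_norm_ge0 x : 0 <= ell_norm x. Proof. by rewrite ell_norm.unlock powR_ge0. Qed.

Lemma ell_sum_norm x : ell_sum p x = (ell_norm x `^ p)%:E.
Proof.
rewrite ell_norm.unlock -powRrM mulVf ?gt_eqF// powRr1 ?fine_ge0 ?ell_sum_ge0//.
by rewrite fineK ?ell_sum_fin.
Qed.

Lemma ell_norm_le (M : R) x :
  0 <= M -> (ell_norm x <= M) = (ell_sum p x <= (M `^ p)%:E)%E.
Proof.
move=> M0; rewrite ell_sum_norm lee_fin.
apply/idP/idP => [h|]; first by rewrite ge0_ler_powR ?nnegrE ?ell_norm_ge0// ltW.
apply: contraTT; rewrite -!ltNge => h.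
by rewrite gt0_ltr_powR ?nnegrE ?ell_norm_ge0.
Qed.

Lemma ell_coord_le x n : `|x n| <= ell_norm x.
Proof.
have : ((`|x n| `^ p)%:E <= ell_sum p x)%E.
  have pos k : (0 <= k)%N -> true -> (0 <= (`|x k| `^ p)%:E :> \bar R)%E.
    by rewrite lee_fin powR_ge0.
  rewrite ell_sum.unlock; apply: le_trans (nneseries_lim_ge n.+1 pos).
  rewrite sumEFin lee_fin big_nat_recr//= lerDr.
  by apply: sumr_ge0 => k _; exact: powR_ge0.
rewrite ell_sum_norm lee_fin; apply: contraTT; rewrite -!ltNge => h.
by rewrite gt0_ltr_powR ?nnegrE ?ell_norm_ge0.
Qed.

Lemma ell_normD x y : ell_norm (x + y) <= ell_norm x + ell_norm y.
Proof.
rewrite -lee_fin EFinD.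
have := ell_minkowski p1 x y.
rewrite (ell_normE x) (ell_normE y).
by rewrite -[X in (X `^ _ <= _)%E]/(ell_sum p (x + y)) (ell_normE (x + y)).
Qed.

Lemma ell_normZ (a : R) x : ell_norm (a *: x) = `|a| * ell_norm x.
Proof.
rewrite ell_norm.unlock.
have -> : ell_sum p (a *: x) = ((`|a| `^ p)%:E * ell_sum p x)%E.
  exact: ell_sumZ.
rewrite fineM ?ell_sum_fin//= powRM ?powR_ge0 ?fine_ge0 ?ell_sum_ge0//.
by rewrite -powRrM mulfV ?gt_eqF// powRr1.
Qed.

Lemma ell_norm0_eq0 x : ell_norm x = 0 -> x = 0.
Proof.
move=> x0; apply/val_inj/funext => n; apply/eqP.
by rewrite -normr_le0 -x0 ell_coord_le.
Qed.

HB.instance Definition _ :=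
  Lmodule_isNormed.Build R (ell p1) ell_normD ell_normZ ell_norm0_eq0.

Lemma ell_complete (F : set_system (ell p1)) :
  ProperFilter F -> cauchy F -> cvg F.
Proof.
move=> FF /cauchyP Fc.
have coord n : cvg ((fun x : ell p1 => x n) @ F).
  apply: R_complete; apply/cauchyP => e e0.
  have [x Fx] := Fc _ e0; exists (x n).
  have : F (fun y : ell p1 => ball (x n) e (y n)); last by [].
  apply: filterS Fx => y; rewrite -!ball_normE /=; apply: le_lt_trans.
  exact: (ell_coord_le (x - y) n).
pose l n : R := lim ((fun x : ell p1 => x n) @ F).
have bnd (e : R) x : 0 < e -> F (ball x e) ->
    (ell_sum p (fun n => x n - l n)%R <= (e `^ p)%:E)%E.
  move=> e0 Fx.
  apply: (@ell_sum_le_lim _ _ p1 _ F FF (fun y : ell p1 => fun n => x n - y n)).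
    by move=> k; apply: cvgB; [exact: cvg_cst|exact: coord].
  apply: filterS Fx => y; rewrite -ball_normE /= => /ltW.
  by rewrite ell_norm_le// ltW.
have [x0 Fx0] := Fc _ ltr01.
have lP : l \in ell_pred p1.
  have x0l : (fun n => x0 n - l n) \in ell_pred p1.
    by rewrite inE (le_lt_trans (bnd _ _ ltr01 Fx0))// ltry.
  have -> : l = (x0 - Ell x0l : ell p1) :> (nat -> R).
    by apply/funext => n /=; rewrite opprB addrC subrK.
  exact: valP.
apply/cvg_ex; exists (Ell lP); apply/cvgrPdist_le => e e0.
have e20 : 0 < e / 2 by rewrite divr_gt0.
have [x Fx] := Fc _ e20.
apply: filterS (Fx) => y Fxy.
have xl : `|x - Ell lP| <= e / 2.
  have := bnd _ _ e20 Fx; rewrite -[X in (X <= _)%E -> _]/(ell_sum p (x - Ell lP)).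
  by rewrite -ell_norm_le// ltW.
have xy : `|x - y| <= e / 2 by move: Fxy; rewrite -ball_normE /= => /ltW.
rewrite [e]splitr; apply: (le_trans (ler_distD x _ _)).
by apply: lerD => //; rewrite distrC.
Qed.

HB.instance Definition _ := Uniform_isComplete.Build (ell p1) ell_complete.

End ell_normed.

Section ell_lattice.
Context (R : realType) (p : R) (p1 : 1 <= p).
Implicit Types x y z : ell p1.

Definition ell_le x y : Prop := forall n, x n <= y n.

Lemma ell_pred_norm x : (fun n => `|x n|) \in ell_pred p1.
Proof.
rewrite inE (@le_lt_trans _ _ (ell_sum p x))//; last by case: x.
by apply: le_ell_sum => // n; rewrite normr_id.
Qed.

Lemma ell_join_subproof x y : (fun n => Num.max (x n) (y n)) \in ell_pred p1.
Proof.
have xy := rpredD (ell_pred_norm x) (ell_pred_norm y).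
rewrite inE; apply: le_lt_trans xy; apply: le_ell_sum => // n.
rewrite [leRHS]ger0_norm ?addr_ge0//.
by have [_|_] := leP (x n) (y n); rewrite ?lerDl ?lerDr.
Qed.

Definition ell_join x y : ell p1 := Ell (ell_join_subproof x y).

Lemma ell_le_anti x y : ell_le x y -> ell_le y x -> x = y.
Proof.
by move=> xy yx; apply/val_inj/funext => n; apply/le_anti; rewrite xy yx.
Qed.

Lemma ell_le_trans y x z : ell_le x y -> ell_le y z -> ell_le x z.
Proof. by move=> xy yz n; exact: le_trans (yz n). Qed.

Lemma ell_leD2r z x y : ell_le x y -> ell_le (x + z) (y + z).
Proof. by move=> xy n; rewrite /= lerD2r. Qed.

Lemma ell_leZ (a : R) x : 0 <= a -> ell_le 0 x -> ell_le 0 (a *: x).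
Proof. by move=> a0 x0 n; apply: mulr_ge0 => //; exact: x0. Qed.

Lemma ell_joinP x y z : ell_le (ell_join x y) z <-> ell_le x z /\ ell_le y z.
Proof.
split=> [xyz|[xz yz] n]; last by rewrite /= ge_max xz yz.
by split=> n; have := xyz n; rewrite /= ge_max => /andP[].
Qed.

HB.instance Definition _ := Lmodule_isRiesz.Build R (ell p1)
  (fun x n => lexx _) ell_le_anti ell_le_trans ell_leD2r ell_leZ ell_joinP.

Lemma ell_norm_modulus x y :
  modulus x <=r modulus y -> `|x| <= `|y| :> R.
Proof.
have modE (u : ell p1) n : modulus u n = `|u n|.
  have -> : modulus u n = Num.max (u n) (- u n) by [].
  by rewrite maxrN.
move=> xy; have xyn n : `|x n| <= `|y n| by rewrite -!modE; exact: xy.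
change (ell_norm x <= ell_norm y).
rewrite ell_norm_le ?ell_norm_ge0// -ell_sum_norm.
exact: le_ell_sum.
Qed.

HB.instance Definition _ :=
  CompleteNormedModule_Riesz_isBanachLattice.Build R (ell p1) ell_norm_modulus.

End ell_lattice.

(* Main.v *)
From HB Require Import structures.
Require Import Defs.
From mathcomp Require Import all_boot all_order all_algebra.
From mathcomp Require Import all_classical all_reals all_analysis.
From mathcomp Require Import ring lra.

(* A tensor [x] in the positive projective product has coordinates [J i x] in    *)
(* [E], and [x] is the limit of its truncations [Q n x] on a closed sublattice.  *)
(* Since [E] is not isomorphic to an AL-space, the lower 1-estimate              *)
(* [\sum_i `|x i| <= K * `|\sum_i x i|] fails for every [K], even for disjoint   *)
(* positive families (otherwise the supremum of the left-hand sides over all     *)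
(* decompositions would be an equivalent AL-norm).  If [x] is a disjoint family  *)
(* nearly attaining the best constant [K] for families of its length, then       *)
(* [\sum_l (1 + r_l) (x) x l], with Rademacher functions [r_l], has positive     *)
(* projective norm at most [2 * `|\sum_l x l|].  In a representation of it as    *)
(* [\sum_k a k (x) y k], each [a k] has boundedly many Rademacher coefficients   *)
(* of size at least [delta * `|a k|], while the other ones contribute to [x] a   *)
(* part which is dominated by [delta] times [\sum_k `|a k| *: modulus (y k)], so *)
(* that extremality applied to this part bounds [K] in terms of the projective   *)
(* norm.  Hence the quotient of the two norms is unbounded.  Placing such blocks *)
(* on disjoint finite sets of coordinates, with weights [2 ^- j], yields         *)
(* infinitely many disjoint positive elements [u k] whose multiples have         *)
(* infinite projective norm already on the coordinates of [u k].  The elements   *)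
(* proportional to [u k] on the coordinates of [u k], for each [k], form the     *)
(* required sublattice.                                                          *)

Set Implicit Arguments.
Unset Strict Implicit.
Unset Printing Implicit Defensive.

Import Order.TTheory GRing.Theory Num.Theory.
Import numFieldNormedType.Exports.
Local Open Scope classical_set_scope.
Local Open Scope ring_scope.

(** The obstruction to lying in the range of [A_L] can be read off coordinates. By
    [projective_approx] every value of [A_L] is [tensor_approximable]: it is a limit, for the norm
    of [F], of finite sums of elementary tensors of bounded cost. The coordinates [J i] of
    [ppt_coordinates] are contractions, so they see such an approximation. For each [j],
    [hard_block] provides a finite positive pattern in [E] whose norm in [F] is at most 1 wherever
    it is placed, whereas a tensor having [gamma] times this pattern among its coordinates has a
    cost of order at least [gamma * 4 ^+ j], up to an additive constant. With weights [2 ^- j] the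
    patterns sum up in [F], while the cost is forced above multiples of [2 ^+ j] for every [j].

    The patterns combine two facts. Not being isomorphic to an AL-space means that lower 1-estimates
    fail on disjoint families ([non_AL_disjoint], from [al_renorming] and
    [lower_estimate_disjoint]); [near_extremal_family] makes this failure quantitative. For [1 < p],
    a bounded vector of [l_p] has a bounded number of large Rademacher coefficients
    ([rademacher_large_coefs]); for [p = 1] a point mass has all of them large.
    [disjoint_combination_estimate] plays one fact against the other.

    Infinite dimension comes from infinitely many copies of the weighted sum on disjoint sets of
    coordinates. A nonzero element of [block_sublattice] contains a nonzero multiple of some copy,
    which keeps it out of the range. *)

Arguments rle_trans {R s} [y x z] _ _.
Arguments rle_anti {R s} [x y] _ _.

(** * Riesz spaces *)

Section riesz_theory.
Context (R : realType) (V : rieszType R).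
Implicit Types (x y z : V) (a : R).

Lemma rleD x y z t : x <=r y -> z <=r t -> x + z <=r y + t.
Proof.
move=> xy zt; apply: (@rle_trans _ _ (y + z)); first exact: rleD2r.
by rewrite ![y + _]addrC; exact: rleD2r.
Qed.

Lemma rle_add2r z x y : x + z <=r y + z <-> x <=r y.
Proof. by split=> [/(rleD2r (- z))|]; [rewrite !addrK|exact: rleD2r]. Qed.

Lemma rle_add2l z x y : z + x <=r z + y <-> x <=r y.
Proof. by rewrite ![z + _]addrC; exact: rle_add2r. Qed.

Lemma rsubr_ge0 x y : 0 <=r y - x <-> x <=r y.
Proof. by rewrite -(rle_add2r x) add0r subrK. Qed.

Lemma rle_subl_addr x y z : x - y <=r z <-> x <=r z + y.
Proof. by rewrite -(rle_add2r y) subrK. Qed.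

Lemma rle_subr_addr x y z : x <=r y - z <-> x + z <=r y.
Proof. by rewrite -(rle_add2r z) subrK. Qed.

Lemma raddr_ge0 x y : 0 <=r x -> 0 <=r y -> 0 <=r x + y.
Proof. by move=> x0 y0; rewrite -(addr0 0); exact: rleD. Qed.

Lemma rler_addl x y : 0 <=r y -> x <=r x + y.
Proof. by move=> y0; rewrite -{1}(addr0 x) rle_add2l. Qed.

Lemma rler_addr x y : 0 <=r y -> x <=r y + x.
Proof. by rewrite addrC; exact: rler_addl. Qed.

Lemma rle_subr x y : 0 <=r y -> x - y <=r x.
Proof. by move=> y0; rewrite rle_subl_addr; exact: rler_addl. Qed.

Lemma rler_scale a x y : 0 <= a -> x <=r y -> a *: x <=r a *: y.
Proof.
by move=> a0 /rsubr_ge0 xy; rewrite -rsubr_ge0 -scalerBr; exact: rscaler_ge0.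
Qed.

Lemma rler_scale_le a b x : a <= b -> 0 <=r x -> a *: x <=r b *: x.
Proof.
move=> ab x0; rewrite -rsubr_ge0 -scalerBl; apply: rscaler_ge0 => //.
by rewrite subr_ge0.
Qed.

Lemma rsum_ge0 (I : Type) (s : seq I) (P : pred I) (F : I -> V) :
  (forall i, P i -> 0 <=r F i) -> 0 <=r \sum_(i <- s | P i) F i.
Proof.
by move=> F0; elim/big_ind : _ => //; [exact: rle_refl|exact: raddr_ge0].
Qed.

Lemma rler_sum (I : Type) (s : seq I) (P : pred I) (F G : I -> V) :
  (forall i, P i -> F i <=r G i) ->
  \sum_(i <- s | P i) F i <=r \sum_(i <- s | P i) G i.
Proof.
move=> FG; elim/big_ind2 : _ => //; first exact: rle_refl.
by move=> *; exact: rleD.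
Qed.

Lemma rle_joinl x y : x <=r rjoin x y.
Proof. by have /rjoinP[] := rle_refl (rjoin x y). Qed.

Lemma rle_joinr x y : y <=r rjoin x y.
Proof. by have /rjoinP[] := rle_refl (rjoin x y). Qed.

Lemma rjoin_lub x y z : x <=r z -> y <=r z -> rjoin x y <=r z.
Proof. by move=> xz yz; apply/rjoinP. Qed.

Lemma rmeet_lel x y : rmeet x y <=r x.
Proof. by have /rmeetP[] := rle_refl (rmeet x y). Qed.

Lemma rmeet_ler x y : rmeet x y <=r y.
Proof. by have /rmeetP[] := rle_refl (rmeet x y). Qed.

Lemma rmeet_glb x y z : z <=r x -> z <=r y -> z <=r rmeet x y.
Proof. by move=> xz yz; apply/rmeetP. Qed.

Lemma rjoinC x y : rjoin x y = rjoin y x.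
Proof.
apply: rle_anti; apply: rjoin_lub;
  by [exact: rle_joinl | exact: rle_joinr].
Qed.

Lemma rmeetC x y : rmeet x y = rmeet y x.
Proof. by rewrite /rmeet rjoinC. Qed.

Lemma rjoin_idPl x y : y <=r x -> rjoin x y = x.
Proof.
move=> yx; apply: rle_anti; last exact: rle_joinl.
by apply: rjoin_lub => //; exact: rle_refl.
Qed.

Lemma rjoinD x y z : rjoin x y + z = rjoin (x + z) (y + z).
Proof.
apply: rle_anti.
  rewrite -rle_subr_addr; apply: rjoin_lub; rewrite rle_subr_addr.
    exact: rle_joinl.
  exact: rle_joinr.
by apply: rjoin_lub; rewrite rle_add2r; [exact: rle_joinl|exact: rle_joinr].
Qed.

Lemma rmeetD x y z : rmeet x y + z = rmeet (x + z) (y + z).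
Proof. by rewrite /rmeet !opprD -rjoinD opprD opprK. Qed.

Lemma rjoin_addmeet x y : rjoin x y + rmeet x y = x + y.
Proof.
have -> : rjoin x y = rjoin (- x) (- y) + (x + y).
  by rewrite rjoinD addrA addNr add0r [x + y]addrC addKr rjoinC.
by rewrite /rmeet addrAC subrr add0r.
Qed.

Lemma rjoinZ a x y : 0 <= a -> a *: rjoin x y = rjoin (a *: x) (a *: y).
Proof.
rewrite le_eqVlt => /predU1P[<-|a0].
  by rewrite !scale0r rjoin_idPl//; exact: rle_refl.
apply: rle_anti.
  have -> : rjoin (a *: x) (a *: y) = a *: (a^-1 *: rjoin (a *: x) (a *: y)).
    by rewrite scalerA divff ?scale1r// gt_eqF.
  apply: rler_scale; first exact: ltW.
  have aK (u : V) : u = a^-1 *: (a *: u) by rewrite scalerA mulVf ?scale1r// gt_eqF.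
  apply: rjoin_lub.
    rewrite {1}(aK x); apply: rler_scale; first by rewrite invr_ge0 ltW.
    exact: rle_joinl.
  rewrite {1}(aK y); apply: rler_scale; first by rewrite invr_ge0 ltW.
  exact: rle_joinr.
by apply: rjoin_lub; apply: rler_scale; rewrite ?ltW//;
  [exact: rle_joinl|exact: rle_joinr].
Qed.

Lemma rjoinZl a b x : 0 <=r x -> rjoin (a *: x) (b *: x) = Num.max a b *: x.
Proof.
move=> x0; have [ab|ba] := leP a b; last first.
  by apply: rjoin_idPl; apply: rler_scale_le => //; exact: ltW.
by rewrite rjoinC; apply: rjoin_idPl; exact: rler_scale_le.
Qed.

Lemma rjoinB x y : rjoin x y = y + rjoin (x - y) 0.
Proof. by rewrite [RHS]addrC rjoinD subrK add0r. Qed.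

Lemma rle_modulus x : x <=r modulus x. Proof. exact: rle_joinl. Qed.

Lemma rleN_modulus x : - x <=r modulus x. Proof. exact: rle_joinr. Qed.

Lemma modulus_ge0 x : 0 <=r modulus x.
Proof.
have -> : modulus x = (2^-1 : R) *: (modulus x + modulus x).
  by rewrite -mulr2n -(scaler_nat 2 (modulus x)) scalerA mulVf ?scale1r.
apply: rscaler_ge0 => //; rewrite -(subrr x).
by apply: rleD; [exact: rle_modulus|exact: rleN_modulus].
Qed.

Lemma ger0_modulus x : 0 <=r x -> modulus x = x.
Proof.
move=> x0; apply: rjoin_idPl; apply: (@rle_trans _ _ 0) => //.
by rewrite -(rle_add2r x) addNr add0r.
Qed.

Lemma modulusN x : modulus (- x) = modulus x.
Proof. by rewrite /modulus opprK rjoinC. Qed.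

Lemma modulus0 : modulus (0 : V) = 0.
Proof. by apply: ger0_modulus; exact: rle_refl. Qed.

Lemma modulus_id x : modulus (modulus x) = modulus x.
Proof. by apply: ger0_modulus; exact: modulus_ge0. Qed.

Lemma modulusD x y : modulus (x + y) <=r modulus x + modulus y.
Proof.
apply: rjoin_lub; first by apply: rleD; exact: rle_modulus.
by rewrite opprD; apply: rleD; exact: rleN_modulus.
Qed.

Lemma modulusZ a x : modulus (a *: x) = `|a| *: modulus x.
Proof.
have pos b : 0 <= b -> modulus (b *: x) = `|b| *: modulus x.
  by move=> b0; rewrite ger0_norm// /modulus rjoinZ// scalerN.
have [a0|a0] := leP 0 a; first exact: pos.
by rewrite -(opprK a) normrN scaleNr modulusN; apply: pos; rewrite oppr_ge0 ltW.
Qed.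

Lemma modulus_sum (I : Type) (s : seq I) (P : pred I) (F : I -> V) :
  modulus (\sum_(i <- s | P i) F i) <=r \sum_(i <- s | P i) modulus (F i).
Proof.
elim/big_ind2 : _ => [|x y z t xy zt|i _]; last exact: rle_refl.
  by rewrite modulus0; exact: rle_refl.
by apply: (rle_trans (modulusD _ _)); exact: rleD.
Qed.

Lemma rmeet_ge0 x y : 0 <=r x -> 0 <=r y -> 0 <=r rmeet x y.
Proof. exact: rmeet_glb. Qed.

Lemma rler_meet x y z t : x <=r y -> z <=r t -> rmeet x z <=r rmeet y t.
Proof.
move=> xy zt; apply: rmeet_glb.
  exact: rle_trans (rmeet_lel _ _) xy.
exact: rle_trans (rmeet_ler _ _) zt.
Qed.

Lemma rmeet_subadd x y z : 0 <=r x -> 0 <=r y -> 0 <=r z ->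
  rmeet x (y + z) <=r rmeet x y + rmeet x z.
Proof.
move=> x0 y0 z0; set m := rmeet _ _.
rewrite addrC rmeetD; apply: rmeet_glb.
  exact: rle_trans (rmeet_lel _ _) (rler_addl _ (rmeet_ge0 _ _)).
rewrite addrC rmeetD; apply: rmeet_glb; last exact: rmeet_ler.
exact: rle_trans (rmeet_lel _ _) (rler_addl _ _).
Qed.

Lemma rmeet_disjoint_le x y u v : 0 <=r x -> 0 <=r y -> x <=r u -> y <=r v ->
  rmeet u v = 0 -> rmeet x y = 0.
Proof.
move=> x0 y0 xu yv uv0; apply: rle_anti; last exact: rmeet_ge0.
by rewrite -uv0; exact: rler_meet.
Qed.

Lemma rmeet_disjointD x y z : 0 <=r x -> 0 <=r y -> 0 <=r z ->
  rmeet x y = 0 -> rmeet x z = 0 -> rmeet x (y + z) = 0.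
Proof.
move=> x0 y0 z0 xy xz; apply: rle_anti; last first.
  by apply: rmeet_ge0 => //; exact: raddr_ge0.
by apply: (rle_trans (rmeet_subadd x0 y0 z0)); rewrite xy xz addr0; exact: rle_refl.
Qed.

Lemma rmeet_disjoint_sum (I : Type) (s : seq I) (P : pred I) (F : I -> V) x :
  0 <=r x -> (forall i, P i -> 0 <=r F i) -> (forall i, P i -> rmeet x (F i) = 0) ->
  rmeet x (\sum_(i <- s | P i) F i) = 0.
Proof.
move=> x0 F0 xF.
suff [] : 0 <=r \sum_(i <- s | P i) F i /\ rmeet x (\sum_(i <- s | P i) F i) = 0 by [].
elim/big_ind : _ => [|y z [y0 xy] [z0 xz]|i Pi]; last by split; [exact: F0|exact: xF].
  split; first exact: rle_refl.
  by apply: rle_anti; [exact: rmeet_ler|apply: rmeet_ge0 => //; exact: rle_refl].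
by split; [exact: raddr_ge0|exact: rmeet_disjointD].
Qed.

Lemma rmeet_pos_neg x : rmeet (rjoin x 0) (rjoin (- x) 0) = 0.
Proof.
have -> : rjoin (- x) 0 = - x + rjoin x 0.
  by rewrite addrC rjoinD subrr add0r rjoinC.
rewrite -{1}[rjoin x 0]add0r -rmeetD /rmeet opprK oppr0 rjoinC.
by rewrite addNr.
Qed.

Lemma rjoin_disjoint x y : rmeet x y = 0 -> rjoin (x - y) 0 = x.
Proof.
move=> xy; have := rjoinB x y; have := rjoin_addmeet x y.
by rewrite xy addr0 => -> /(congr1 (fun z => z - y)); rewrite addrK addrC addKr.
Qed.

Lemma rler_disjointD x y h : x <=r h -> y <=r h -> rmeet x y = 0 -> x + y <=r h.
Proof. by move=> xh yh xy; rewrite -rjoin_addmeet xy addr0; exact: rjoin_lub. Qed.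

Lemma rler_disjoint_sum (n : nat) (w : nat -> V) h : 0 <=r h ->
  (forall i, (i < n)%N -> 0 <=r w i) -> (forall i, (i < n)%N -> w i <=r h) ->
  (forall i j, (i < j < n)%N -> rmeet (w i) (w j) = 0) ->
  \sum_(i < n) w i <=r h.
Proof.
move=> h0; elim: n => [|n IHn] w0 wh ww; first by rewrite big_ord0.
rewrite big_ord_recr/=; apply: rler_disjointD.
- by apply: IHn => [i ni|i ni|i j /andP[ij jn]];
    [apply: w0|apply: wh|apply: ww]; rewrite ?ij//= ltnW.
- exact: wh.
- rewrite rmeetC; apply: rmeet_disjoint_sum => [|i _|i _].
  + exact: w0.
  + by apply: w0; rewrite ltnW// ltnS.
  + by rewrite rmeetC; apply: ww; rewrite ltn_ord ltnS/=.
Qed.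

End riesz_theory.

Lemma linear_packed (R : pzRingType) (U W : lmodType R) (f : U -> W) :
  linear f -> exists g : {linear U -> W}, f = g.
Proof.
move=> lf.
by exists (HB.pack_for {linear U -> W} f (GRing.isLinear.Build R U W *:%R f lf)).
Qed.

(** * Riesz homomorphisms *)

Section riesz_hom_theory.
Context (R : realType) (V W : rieszType R).
Implicit Types (f g : V -> W).

Lemma riesz_hom0 f : riesz_hom f -> f 0 = 0.
Proof. by move=> [/linear_packed[g ->] _]; rewrite linear0. Qed.

Lemma riesz_homN f x : riesz_hom f -> f (- x) = - f x.
Proof. by move=> [/linear_packed[g ->] _]; rewrite linearN. Qed.

Lemma riesz_homB f x y : riesz_hom f -> f (x - y) = f x - f y.
Proof. by move=> [/linear_packed[g ->] _]; rewrite linearB. Qed.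

Lemma riesz_homD f x y : riesz_hom f -> f (x + y) = f x + f y.
Proof. by move=> [/linear_packed[g ->] _]; rewrite linearD. Qed.

Lemma riesz_homZ f a x : riesz_hom f -> f (a *: x) = a *: f x.
Proof. by move=> [/linear_packed[g ->] _]; rewrite linearZ. Qed.

Lemma riesz_hom_sum f (I : Type) (s : seq I) (P : pred I) (F : I -> V) :
  riesz_hom f -> f (\sum_(i <- s | P i) F i) = \sum_(i <- s | P i) f (F i).
Proof. by move=> [/linear_packed[g ->] _]; rewrite linear_sum. Qed.

Lemma riesz_hom_ge0 f x : riesz_hom f -> 0 <=r x -> 0 <=r f x.
Proof.
move=> hf x0; rewrite -(rjoin_idPl x0) hf.2 (riesz_hom0 hf).
exact: rle_joinr.
Qed.

Lemma riesz_hom_le f x y : riesz_hom f -> x <=r y -> f x <=r f y.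
Proof.
move=> hf /rsubr_ge0/(riesz_hom_ge0 hf).
by rewrite riesz_homB// rsubr_ge0.
Qed.

Lemma riesz_hom_modulus f x : riesz_hom f -> f (modulus x) = modulus (f x).
Proof. by move=> hf; rewrite /modulus hf.2 riesz_homN. Qed.

Lemma riesz_hom_meet f x y : riesz_hom f -> f (rmeet x y) = rmeet (f x) (f y).
Proof. by move=> hf; rewrite /rmeet riesz_homN// hf.2 !riesz_homN. Qed.

(** By [rjoinB] every join is a translate of a positive part. *)
Lemma riesz_hom_pos f : linear f ->
  (forall x, f (rjoin x 0) = rjoin (f x) 0) -> riesz_hom f.
Proof.
move=> lf fp; split=> // x y; rewrite [in LHS]rjoinB [in RHS]rjoinB.
by case/linear_packed : lf fp => g -> fp; rewrite linearD/= fp linearB.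
Qed.

(** [f \+ g] sends the positive and the negative part of [x] to disjoint elements: the cross terms
    vanish by hypothesis, the others because [f] and [g] preserve meets. Then [rjoin_disjoint]
    identifies the positive part of the image. *)
Lemma riesz_hom_disjointD f g : riesz_hom f -> riesz_hom g ->
  (forall x y, 0 <=r x -> 0 <=r y -> rmeet (f x) (g y) = 0) ->
  riesz_hom (f \+ g).
Proof.
move=> hf hg fg; apply: riesz_hom_pos => [a x y|x].
  by rewrite /= hf.1 hg.1 scalerDr addrACA.
rewrite /=; set u := rjoin x 0; set v := rjoin (- x) 0.
have u0 : 0 <=r u by exact: rle_joinr.
have v0 : 0 <=r v by exact: rle_joinr.
have xuv : x = u - v.
  have -> : v = - x + u by rewrite addrC rjoinD subrr add0r rjoinC.
  by rewrite opprD opprK addrCA subrr addr0.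
have p0 := riesz_hom_ge0.
have [fu0 fv0 gu0 gv0] : [/\ 0 <=r f u, 0 <=r f v, 0 <=r g u & 0 <=r g v].
  by split; exact: p0.
have uv : rmeet u v = 0 by exact: rmeet_pos_neg.
rewrite {1 2}xuv !riesz_homB// addrACA -opprD; apply/esym/rjoin_disjoint.
have h (k : V -> W) : riesz_hom k -> rmeet (k u) (k v) = 0.
  by move=> hk; rewrite -riesz_hom_meet// uv riesz_hom0.
apply: rmeet_disjointD => //; [exact: raddr_ge0|..]; rewrite rmeetC;
  apply: rmeet_disjointD => //; try exact: fg.
- by rewrite rmeetC; exact: h.
- by rewrite rmeetC; exact: fg.
- by rewrite rmeetC; exact: h.
Qed.

End riesz_hom_theory.

(** * Norm and order in Banach lattices *)

Section banach_lattice_theory.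
Context (R : realType) (X : banachLatticeType R).
Implicit Types x y z : X.

Lemma norm_modulus x : `|modulus x| = `|x|.
Proof.
by apply/le_anti/andP; split; apply: ler_norm_modulus;
  rewrite modulus_id; exact: rle_refl.
Qed.

Lemma ler_norm_dominated x y : modulus x <=r y -> `|x| <= `|y|.
Proof.
move=> xy; apply: ler_norm_modulus; rewrite (@ger0_modulus _ _ y)//.
exact: rle_trans (modulus_ge0 _) xy.
Qed.

Lemma ler_norm_pos x y : 0 <=r x -> x <=r y -> `|x| <= `|y|.
Proof. by move=> x0 xy; apply: ler_norm_dominated; rewrite ger0_modulus. Qed.

Lemma norm_rjoinB x y z t : `|rjoin x y - rjoin z t| <= `|x - z| + `|y - t|.
Proof.
rewrite -(norm_modulus (x - z)) -(norm_modulus (y - t)).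
apply: le_trans (ler_normD _ _); apply: ler_norm_dominated.
have key (a b c d : X) :
    rjoin a b - rjoin c d <=r modulus (a - c) + modulus (b - d).
  have le0 := @modulus_ge0 R X.
  rewrite rle_subl_addr; apply: rjoin_lub.
    rewrite -[X in X <=r _](subrK c); apply: rleD; last exact: rle_joinl.
    exact: rle_trans (rle_modulus _) (rler_addl _ (le0 _)).
  rewrite -[X in X <=r _](subrK d); apply: rleD; last exact: rle_joinr.
  exact: rle_trans (rle_modulus _) (rler_addr _ (le0 _)).
apply: rjoin_lub; first exact: key.
by rewrite opprB -(modulusN (x - z)) -(modulusN (y - t)) !opprB; exact: key.
Qed.

(** Fremlin's universal property asks for Archimedean targets. All multiples of the norm of the
    positive part of [x] stay below the norm of [y], so this positive part is zero. *)
Lemma banach_archimedean : archimedean X.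
Proof.
move=> x y xy; set u := rjoin x 0.
have u0 : 0 <=r u by exact: rle_joinr.
suff u00 : u = 0 by rewrite -u00; exact: rle_joinl.
apply/eqP; rewrite -normr_le0 leNgt; apply/negP => un.
have ub n : `|u| *+ n <= `|modulus y|.
  rewrite -normrMn; apply: ler_norm_pos.
    by rewrite -scaler_nat; exact: rscaler_ge0.
  rewrite -scaler_nat rjoinZ// scaler0 scaler_nat; apply: rjoin_lub.
    exact: rle_trans (xy n) (rle_modulus _).
  exact: modulus_ge0.
have := archi_boundP (divr_ge0 (normr_ge0 (modulus y)) (normr_ge0 u)).
rewrite ltr_pdivrMr// mulr_natl => /lt_le_trans/(_ (ub _)).
by rewrite ltxx.
Qed.

End banach_lattice_theory.

(** * AL-renorming *)

Section al_renorming.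
Context (R : realType) (E : banachLatticeType R) (K : R).
Hypothesis hK : forall s : seq E, (forall z, z \in s -> 0 <=r z) ->
  \sum_(z <- s) `|z| <= K * `|\sum_(z <- s) z|.
Implicit Types (x y z : E) (s : seq E).

Definition al_sums x : set R := [set r | exists s,
  [/\ forall z, z \in s -> 0 <=r z, \sum_(z <- s) z <=r modulus x
    & r = \sum_(z <- s) `|z|]].

(** A lattice norm that is additive on the positive cone and dominates the given norm is at least
    each element of [al_sums x], so this is the smallest candidate. The hypothesis [hK] makes it
    finite and equivalent to the given norm. *)
Definition al_norm x : R := sup (al_sums x).

Lemma seq_sum_ge0 s : (forall z, z \in s -> 0 <=r z) -> 0 <=r \sum_(z <- s) z.
Proof. by move=> s0; rewrite big_seq; exact: rsum_ge0. Qed.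

Lemma al_sums_ub x : ubound (al_sums x) (`|K| * `|x|).
Proof.
move=> _ [s [s0 sx ->]]; apply: (le_trans (hK s0)).
apply: (@le_trans _ _ (`|K| * `|\sum_(z <- s) z|)).
  by apply: ler_wpM2r => //; exact: ler_norm.
by rewrite ler_wpM2l// -(norm_modulus x); apply: ler_norm_pos => //; exact: seq_sum_ge0.
Qed.

Lemma al_norm_ub x s : (forall z, z \in s -> 0 <=r z) ->
  \sum_(z <- s) z <=r modulus x -> \sum_(z <- s) `|z| <= al_norm x.
Proof.
move=> s0 sx; apply: ub_le_sup; last by exists s.
by exists (`|K| * `|x|); exact: al_sums_ub.
Qed.

Lemma al_norm_le x M :
  (forall s, (forall z, z \in s -> 0 <=r z) -> \sum_(z <- s) z <=r modulus x ->
    \sum_(z <- s) `|z| <= M) -> al_norm x <= M.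
Proof.
move=> h; apply: ge_sup; last by move=> _ [s [s0 sx ->]]; exact: h.
by exists 0, [::]; rewrite !big_nil; split=> //; exact: modulus_ge0.
Qed.

Lemma ler_al_norm x : `|x| <= al_norm x.
Proof.
have := @al_norm_ub x [:: modulus x]; rewrite !big_seq1 norm_modulus; apply.
  by move=> z; rewrite inE => /eqP ->; exact: modulus_ge0.
exact: rle_refl.
Qed.

Lemma al_norm_leK x : al_norm x <= `|K| * `|x|.
Proof. by apply: al_norm_le => s s0 sx; apply: (@al_sums_ub x); exists s. Qed.

Lemma le_al_norm x y : modulus x <=r modulus y -> al_norm x <= al_norm y.
Proof.
by move=> xy; apply: al_norm_le => s s0 sx; apply: al_norm_ub => //; exact: rle_trans xy.
Qed.

(** Each [z] is cut into [rmeet z x] and a remainder, which fits below [y]; what is used is then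
    subtracted from [x] and [y]. This yields the triangle inequality for [al_norm], whereas the
    reverse inequality on the positive cone only needs concatenation. *)
Lemma seq_riesz_decomposition s x y : (forall z, z \in s -> 0 <=r z) ->
  0 <=r x -> 0 <=r y -> \sum_(z <- s) z <=r x + y ->
  exists s1 s2, [/\ (forall z, z \in s1 -> 0 <=r z) /\ (forall z, z \in s2 -> 0 <=r z),
    \sum_(z <- s1) z <=r x, \sum_(z <- s2) z <=r y
    & \sum_(z <- s) `|z| <= \sum_(z <- s1) `|z| + \sum_(z <- s2) `|z|].
Proof.
elim: s x y => [|z s IHs] x y s0 x0 y0 sxy.
  by exists [::], [::]; rewrite !big_nil addr0.
have z0 : 0 <=r z by apply: s0; rewrite mem_head.
have s0' u : u \in s -> 0 <=r u by move=> us; apply: s0; rewrite inE us orbT.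
pose a := rmeet z x; pose b := z - a.
have a0 : 0 <=r a by exact: rmeet_ge0.
have b0 : 0 <=r b by rewrite rsubr_ge0; exact: rmeet_lel.
have zxy : z <=r x + y.
  apply: rle_trans sxy; rewrite big_cons; apply: rler_addl; exact: seq_sum_ge0.
have ax : a <=r x by exact: rmeet_ler.
have bly : b <=r y.
  rewrite /b rle_subl_addr addrC rmeetD; apply: rmeet_glb => //.
  exact: rler_addl.
have [||| s1 [s2 [[s10 s20] s1x s2y le12]]] := IHs (x - a) (y - b) s0'.
- by rewrite rsubr_ge0.
- by rewrite rsubr_ge0.
- rewrite addrACA -opprD [a + b]addrC subrK rle_subr_addr addrC.
  by rewrite [_ + z]addrC [y + x]addrC; rewrite big_cons in sxy.
exists (a :: s1), (b :: s2); rewrite !big_cons; split.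
- by split=> u; rewrite inE => /predU1P[->//|]; [exact: s10|exact: s20].
- by rewrite addrC -rle_subr_addr.
- by rewrite addrC -rle_subr_addr.
- rewrite addrACA lerD//.
  by have {1}-> : z = a + b; [rewrite addrC subrK|exact: ler_normD].
Qed.

Lemma al_norm_add x y : 0 <=r x -> 0 <=r y -> al_norm x + al_norm y <= al_norm (x + y).
Proof.
move=> x0 y0; rewrite -lerBrDr; apply: al_norm_le => s s0 sx.
rewrite lerBrDr addrC -lerBrDr; apply: al_norm_le => t t0 ty.
rewrite lerBrDr addrC -big_cat/=; apply: al_norm_ub.
  by move=> z; rewrite mem_cat => /orP[/s0|/t0].
rewrite big_cat/= ger0_modulus; last exact: raddr_ge0.
by move: sx ty; rewrite !ger0_modulus//; exact: rleD.
Qed.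

Lemma al_norm_triangle x y : al_norm (x + y) <= al_norm x + al_norm y.
Proof.
apply: al_norm_le => s s0 sxy.
have [||| s1 [s2 [[s10 s20] s1x s2y]]] := @seq_riesz_decomposition s (modulus x) (modulus y) s0.
- exact: modulus_ge0.
- exact: modulus_ge0.
- exact: rle_trans (modulusD _ _).
by move=> /le_trans; apply; apply: lerD; exact: al_norm_ub.
Qed.

Lemma al_norm0 : al_norm 0 = 0.
Proof.
by apply/le_anti; rewrite (le_trans _ (ler_al_norm 0)) ?normr0// andbT
  (le_trans (al_norm_leK 0))// normr0 mulr0.
Qed.

Lemma al_normZ (a : R) x : al_norm (a *: x) = `|a| * al_norm x.
Proof.
have half b y : b != 0 -> al_norm (b *: y) <= `|b| * al_norm y.
  move=> b0; apply: al_norm_le => s s0 sy.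
  have nb : 0 < `|b| by rewrite normr_gt0.
  rewrite mulrC -ler_pdivrMr// mulrC mulr_sumr.
  have -> : \sum_(z <- s) `|b|^-1 * `|z| =
      \sum_(z <- [seq `|b|^-1 *: z | z <- s]) `|z|.
    by rewrite big_map; apply: eq_bigr => z _; rewrite normrZ ger0_norm ?invr_ge0.
  apply: al_norm_ub.
    by move=> _ /mapP[z zs ->]; apply: rscaler_ge0; [rewrite invr_ge0|exact: s0].
  rewrite big_map -scaler_sumr.
  have -> : modulus y = `|b|^-1 *: (modulus (b *: y)).
    by rewrite modulusZ scalerA mulVf ?scale1r// gt_eqF.
  by apply: rler_scale => //; rewrite invr_ge0.
have [->|a0] := eqVneq a 0; first by rewrite scale0r normr0 mul0r al_norm0.
apply/le_anti; rewrite half//= mulrC -ler_pdivlMr ?normr_gt0// mulrC -normfV.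
have {1}-> : x = a^-1 *: (a *: x) by rewrite scalerA mulVf ?scale1r.
by apply: half; rewrite invr_eq0.
Qed.

(** The estimate is an argument of this copy of [E], so that the structures whose axioms depend on
    it can be attached to the type. *)
Definition al_renormed of (forall s : seq E, (forall z, z \in s -> 0 <=r z) ->
  \sum_(z <- s) `|z| <= K * `|\sum_(z <- s) z|) : Type := E.

Local Notation L := (al_renormed hK).

HB.instance Definition _ := GRing.Lmodule.copy L (Riesz.sort E).

Lemma al_norm0_eq0 (x : L) : al_norm x = 0 -> x = 0.
Proof.
move=> x0; have : `|x : E| <= 0 by rewrite -x0 ler_al_norm.
by rewrite normr_le0 => /eqP.
Qed.

HB.instance Definition _ := Lmodule_isNormed.Build R L
  al_norm_triangle al_normZ al_norm0_eq0.

Lemma al_renormed_complete (G : set_system L) : ProperFilter G -> cauchy G -> cvg G.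
Proof.
move=> GG /cauchyP Gc.
have Gc' : cauchy (G : set_system E).
  apply/cauchyP => e e0; have [x Gx] := Gc _ e0; exists x.
  apply: filterS Gx => y; rewrite -!ball_normE /=; apply: le_lt_trans.
  exact: ler_al_norm.
have /cvg_ex[l Gl] : cvg (G : set_system E) by exact: (@cauchy_cvg E G GG Gc').
apply/cvg_ex; exists l; apply/cvgrPdist_lt => e e0.
have K1 : 0 < `|K| + 1 by rewrite ltr_wpDl.
have eK : 0 < e / (`|K| + 1) by rewrite divr_gt0.
move/cvgrPdist_lt : Gl => /(_ _ eK); apply: filterS => y yl.
apply: le_lt_trans (al_norm_leK _) _.
rewrite ltr_pdivlMr// in yl; apply: le_lt_trans yl.
by rewrite mulrC ler_wpM2l// lerDl.
Qed.

HB.instance Definition _ := Uniform_isComplete.Build L al_renormed_complete.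

HB.instance Definition _ := Lmodule_isRiesz.Build R L
  (@rle_refl R E) (@rle_anti R E) (@rle_trans R E) (@rleD2r R E)
  (@rscaler_ge0 R E) (@rjoinP R E).

HB.instance Definition _ :=
  CompleteNormedModule_Riesz_isBanachLattice.Build R L le_al_norm.

Lemma al_renorming : exists L : banachLatticeType R, AL_space L /\ lattice_isomorphic E L.
Proof.
exists L; split.
  by move=> x y x0 y0; apply/le_anti; rewrite ler_normD/=; exact: al_norm_add.
have K1 : 0 < `|K| + 1 by rewrite ltr_wpDl.
exists (id : E -> L), (id : L -> E); split=> //.
  move=> x; apply/cvgrPdist_lt => e e0.
  have eK : 0 < e / (`|K| + 1) by rewrite divr_gt0.
  have /cvgrPdist_lt/(_ _ eK) : id y @[y --> (x : E)] --> (x : E) by exact: cvg_id.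
  apply: filterS => y; rewrite ltr_pdivlMr//=; apply: le_lt_trans.
  by apply: (le_trans (al_norm_leK (x - y))); rewrite mulrC ler_wpM2l// lerDl.
move=> x A /(@nbhs_ballP R E)[e /= e0 xA]; apply/(@nbhs_ballP R L).
exists e => //= y; rewrite -ball_normE /= => xy; apply: xA.
by rewrite -ball_normE /=; apply: le_lt_trans xy; exact: ler_al_norm.
Qed.

End al_renorming.

(** * Lower 1-estimates *)

Section disjoint_families.
Context (R : realType).

Definition disjoint_family (V : rieszType R) (n : nat) (x : nat -> V) : Prop :=
  (forall i, (i < n)%N -> 0 <=r x i) /\
  (forall i j, (i < j < n)%N -> rmeet (x i) (x j) = 0).

Lemma disjoint_family_le (V : rieszType R) n (x y : nat -> V) :
  disjoint_family n y -> (forall i, (i < n)%N -> 0 <=r x i) ->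
  (forall i, (i < n)%N -> x i <=r y i) -> disjoint_family n x.
Proof.
move=> [y0 yy] x0 xy; split=> // i j ijn; have /andP[ij jn] := ijn.
have i_n := ltn_trans ij jn.
by apply: rmeet_disjoint_le (yy _ _ ijn); [exact: x0|exact: x0|exact: xy|exact: xy].
Qed.

Lemma disjoint_familyZ (V : rieszType R) n (x : nat -> V) (a : R) : 0 <= a ->
  disjoint_family n x -> disjoint_family n (fun i => a *: x i).
Proof.
move=> a0 [x0 xx]; split=> [i ni|i j ij].
  by apply: rscaler_ge0 => //; exact: x0.
by rewrite /rmeet -!scalerN -rjoinZ// -scalerN -/(rmeet _ _) xx// scaler0.
Qed.

Lemma ler_archimedean_div (a b c : R) : (forall m : nat, a <= b + c / m.+1%:R) -> a <= b.
Proof.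
move=> h; apply/ler_addgt0Pr => e e0.
have c1 : 0 <= `|c| / e by rewrite divr_ge0// ltW.
apply: le_trans (h (Num.bound (`|c| / e))) _; rewrite lerD2l.
rewrite ler_pdivrMr// mulrC -ler_pdivrMr//.
apply: (@le_trans _ _ (`|c| / e)).
  by rewrite ler_pM2r ?invr_gt0// ler_norm.
by apply: ltW; apply: (lt_trans (archi_boundP c1)); rewrite ltr_nat.
Qed.

Section slices.
Context (V : rieszType R) (h : V).
Hypothesis h0 : 0 <=r h.

(* The part of [b] between the heights [l h] and [(l + 1) h], see slice_diff. *)
Definition slice (l : nat) (b : V) : V := rmeet (rjoin (b - h *+ l) 0) h.

Lemma slice_ge0 l b : 0 <=r slice l b.
Proof. by apply: rmeet_ge0 => //; exact: rle_joinr. Qed.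

Lemma slice_le l b : slice l b <=r h. Proof. exact: rmeet_ler. Qed.

Lemma slice_mono l b c : b <=r c -> slice l b <=r slice l c.
Proof.
move=> bc; apply: rler_meet; last exact: rle_refl.
apply: rjoin_lub; last exact: rle_joinr.
by apply: rle_trans (rle_joinl _ _); rewrite rle_add2r.
Qed.

Lemma slice_diff l b : slice l b = rmeet b (h *+ l.+1) - rmeet b (h *+ l).
Proof.
have -> : slice l b = rmeet b (h + rmeet b (h *+ l)) - rmeet b (h *+ l).
  rewrite [RHS]rmeetD addrK /slice; congr rmeet.
  by rewrite /rmeet opprK [RHS]addrC rjoinD addNr rjoinC [- _ + b]addrC.
congr (_ - _); apply: rle_anti; apply: rmeet_glb; try exact: rmeet_lel.
  apply: rle_trans (rmeet_ler _ _) _; rewrite mulrS rle_add2l; exact: rmeet_ler.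
rewrite addrC rmeetD; apply: rmeet_glb.
  exact: rle_trans (rmeet_lel _ _) (rler_addl _ h0).
by rewrite -mulrSr; exact: rmeet_ler.
Qed.

Lemma sum_slice l m b : \sum_(i < m) slice (l + i) b =
  rmeet b (h *+ (l + m)) - rmeet b (h *+ l).
Proof.
elim: m => [|m IHm]; first by rewrite big_ord0 addn0 subrr.
by rewrite big_ord_recr/= IHm slice_diff addnS addrC addrA subrK.
Qed.

(** The two elements lie below the positive and the negative part of [b - h *+ l.+1]: the next slice
    starts only where the present one is full. *)
Lemma slice_disjoint l b : rmeet (slice l.+1 b) (h - slice l b) = 0.
Proof.
apply: (@rmeet_disjoint_le _ _ _ _ (rjoin (b - h *+ l.+1) 0)
                                   (rjoin (- (b - h *+ l.+1)) 0)).
- exact: slice_ge0.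
- by rewrite rsubr_ge0; exact: slice_le.
- exact: rmeet_lel.
- rewrite rle_subl_addr addrC rmeetD; apply: rmeet_glb; last first.
    by apply: rler_addl; exact: rle_joinr.
  have {1}-> : h = (b - h *+ l) + (- (b - h *+ l.+1)).
    by rewrite mulrSr opprB !addrA subrK addrC addKr.
  by apply: rleD; exact: rle_joinl.
- exact: rmeet_pos_neg.
Qed.

End slices.

(* With [h] a small multiple of the sum, the slices of the successive partial   *)
(* sums of [x] are disjoint at each fixed height, and summing them over all     *)
(* heights recovers [x] up to [h].                                              *)
Lemma lower_estimate_disjoint (E : banachLatticeType R) (K : R) : 0 <= K ->
  (forall n (x : nat -> E), disjoint_family n x ->
    \sum_(i < n) `|x i| <= K * `|\sum_(i < n) x i|) ->
  forall n (x : nat -> E), (forall i, (i < n)%N -> 0 <=r x i) ->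
    \sum_(i < n) `|x i| <= K * `|\sum_(i < n) x i|.
Proof.
move=> K0 hK n x x0; pose X i := \sum_(l < i) x l.
apply: (@ler_archimedean_div _ _ (n%:R * `|X n|)) => m.
pose h := m.+1%:R^-1 *: X n.
have XS i : X i.+1 = X i + x i by rewrite /X big_ord_recr.
have Xm i j : (i <= j <= n)%N -> X i <=r X j.
  elim: j => [|j IHj] /andP[]; first by rewrite leqn0 => /eqP -> _; exact: rle_refl.
  rewrite leq_eqVlt => /predU1P[-> _|ij jn]; first exact: rle_refl.
  apply: (@rle_trans _ _ (X j)); first by apply: IHj; rewrite -ltnS ij ltnW.
  by rewrite XS; apply: rler_addl; exact: x0.
have X0 i : (i <= n)%N -> 0 <=r X i.
  move=> ni; have := Xm 0%N i; rewrite /X big_ord0; exact.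
have h0 : 0 <=r h by apply: rscaler_ge0; [rewrite invr_ge0|exact: X0].
have hXn : h *+ m.+1 = X n by rewrite -scaler_nat scalerA divff ?scale1r.
(* For [i < j] the first factor of [w l i] is below [slice h l.+1 (X j)] and [w l j] is below
   [h - slice h l (X j)], so [slice_disjoint] applies. The shift from [l] to [l.+1] that this
   requires costs the extra [h] in [xw]. *)
pose w l i := rmeet (slice h l.+1 (X i.+1)) (h - slice h l (X i)).
have w0 l i : 0 <=r w l i.
  apply: rmeet_ge0; first exact: slice_ge0.
  by rewrite rsubr_ge0; exact: slice_le.
have wh l i : w l i <=r h by apply: rle_trans (rmeet_lel _ _) (slice_le _ _ _).
have wd l : disjoint_family n (w l).
  split=> // i j /andP[ij jn].
  apply: rmeet_disjoint_le (slice_disjoint h0 l (X j)) => //.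
    apply: rle_trans (rmeet_lel _ _) _; apply: slice_mono => //.
    by apply: Xm; rewrite ij ltnW.
  exact: rmeet_ler.
have xw (i : 'I_n) : x i <=r \sum_(l < m) w l i + h.
  rewrite -rle_subl_addr.
  apply: (@rle_trans _ _ (\sum_(l < m) (slice h (1 + l) (X i.+1) - slice h (0 + l) (X i)))).
    rewrite sumrB !sum_slice// add0n add1n mulr0n mulr1n hXn.
    have -> : x i - h = (X i.+1 - h) - X i.
      by rewrite XS [X i + x i]addrC [RHS]addrAC addrK.
    apply: rleD; first apply: rleD.
    - apply: rmeet_glb; first exact: rle_refl.
      by apply: Xm; rewrite ltn_ord leqnn.
    - by rewrite rleN2; exact: rmeet_ler.
    - rewrite rleN2 rle_subl_addr.
      apply: (rle_trans (rmeet_lel _ _)); apply: rler_addl.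
      by apply: rmeet_ge0; [apply: X0; exact: ltnW|exact: rle_refl].
  apply: rler_sum => l _; apply: rmeet_glb.
    by apply: rle_subr; exact: slice_ge0.
  by rewrite rle_add2r; exact: slice_le.
have nh : `|h| = `|X n| / m.+1%:R.
  by rewrite normrZ ger0_norm ?invr_ge0// mulrC.
have nx (i : 'I_n) : `|x i| <= \sum_(l < m) `|w l i| + `|h|.
  apply: (le_trans (ler_norm_pos (x0 _ (ltn_ord i)) (xw i))).
  by apply: (le_trans (ler_normD _ _)); rewrite lerD2r ler_norm_sum.
apply: (le_trans (ler_sum _ (fun i _ => nx i))).
rewrite big_split/= sumr_const card_ord exchange_big/= -[`|h| *+ n]mulr_natl.
rewrite -mulrA -nh lerD2r.
apply: (@le_trans _ _ (\sum_(l < m) K * `|h|)).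
  apply: ler_sum => l _; apply: (le_trans (hK _ _ (wd l))).
  apply: ler_wpM2l => //; apply: ler_norm_pos.
    by apply: rsum_ge0.
  by apply: rler_disjoint_sum => //; exact: (wd l).2.
rewrite sumr_const card_ord nh -mulrnAr; apply: ler_wpM2l => //.
rewrite -mulr_natr -mulrA ler_piMr// mulrC ler_pdivrMr// mul1r ler_nat.
by rewrite leqnSn.
Qed.

End disjoint_families.

Section lower_estimates.
Context (R : realType) (E : banachLatticeType R).

Lemma non_AL_disjoint :
  (~ exists L : banachLatticeType R, AL_space L /\ lattice_isomorphic E L) ->
  forall K : R, 0 <= K -> exists n (x : nat -> E),
    disjoint_family n x /\ K * `|\sum_(i < n) x i| < \sum_(i < n) `|x i|.
Proof.
move=> nAL K K0; apply: contrapT => nex; apply: nAL.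
apply: (@al_renorming R E K) => s s0.
rewrite (big_nth 0) [X in _ <= _ * `|X|](big_nth 0) !big_mkord; apply: (lower_estimate_disjoint K0).
  move=> n x dx; rewrite leNgt; apply/negP => xK; apply: nex.
  by exists n, x.
by move=> i si; apply: s0; exact: mem_nth.
Qed.

Lemma disjoint_le_sum n (x : nat -> E) i : disjoint_family n x -> (i < n)%N ->
  `|x i| <= `|\sum_(i < n) x i|.
Proof.
move=> [x0 _] i_n; apply: ler_norm_pos; first exact: x0.
rewrite (bigD1 (Ordinal i_n))//=; apply: rler_addl.
by apply: rsum_ge0 => j _; exact: x0.
Qed.

(** [K] is the best constant for the length [n] alone, which is at most [n]; over all lengths
    together there is no finite constant. It is at least [K0] because some family of length [n]
    violates the estimate with constant [Num.max K0 1]. *)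
Lemma near_extremal_family :
  (~ exists L : banachLatticeType R, AL_space L /\ lattice_isomorphic E L) ->
  forall K0 : R, exists n (x : nat -> E) (K : R),
    [/\ K0 <= K /\ 0 <= K, disjoint_family n x, `|\sum_(i < n) x i| <= 1,
      K / 2 <= \sum_(i < n) `|x i|
    & forall y : nat -> E, disjoint_family n y ->
        \sum_(i < n) `|y i| <= K * `|\sum_(i < n) y i|].
Proof.
move=> nAL K0; pose K1 := Num.max K0 1.
have K11 : 1 <= K1 by rewrite le_max lexx orbT.
have [n [x [dx xK]]] := non_AL_disjoint nAL (le_trans ler01 K11).
pose A := [set r : R | exists y : nat -> E, [/\ disjoint_family n y,
  `|\sum_(i < n) y i| <= 1 & r = \sum_(i < n) `|y i|]].
have ubA : has_ubound A.
  exists n%:R => _ [y [dy y1 ->]].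
  rewrite -[n in leRHS]card_ord -sumr_const; apply: ler_sum => i _.
  by apply: le_trans y1; exact: disjoint_le_sum.
have normalize (y : nat -> E) : disjoint_family n y ->
    \sum_(i < n) `|y i| <= sup A * `|\sum_(i < n) y i|.
  move=> dy; have [y0|y0] := eqVneq `|\sum_(i < n) y i| 0.
    rewrite big1 ?y0 ?mulr0// => i _; apply/le_anti.
    by rewrite normr_ge0 andbT -[leRHS]y0; exact: (disjoint_le_sum dy).
  have yp : 0 < `|\sum_(i < n) y i| by rewrite lt_def y0 normr_ge0.
  rewrite -ler_pdivrMr// mulrC mulr_sumr; apply: ub_le_sup => //.
  exists (fun i => `|\sum_(i < n) y i|^-1 *: y i); split.
  - by apply: disjoint_familyZ => //; rewrite invr_ge0.
  - by rewrite -scaler_sumr normrZ ger0_norm ?invr_ge0// mulVf.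
  - by apply: eq_bigr => i _; rewrite normrZ ger0_norm ?invr_ge0.
have K1A : K1 <= sup A.
  have : K1 * `|\sum_(i < n) x i| <= sup A * `|\sum_(i < n) x i|.
    by apply: (le_trans (ltW xK)); exact: normalize.
  have [x00|x00] := eqVneq `|\sum_(i < n) x i| 0; last first.
    by rewrite ler_pM2r// lt_def x00 normr_ge0.
  by have := lt_le_trans xK (normalize _ dx); rewrite x00 !mulr0 ltxx.
have Apos : 0 < sup A / 2 by rewrite divr_gt0// (lt_le_trans ltr01)// (le_trans K11).
have hsA : has_sup A.
  split=> //; exists 0, (fun=> 0); split; last by rewrite big1// => *; rewrite normr0.
    split=> *; first exact: rle_refl.
    by apply: rle_anti; [exact: rmeet_lel|apply: rmeet_ge0; exact: rle_refl].
  by rewrite big1// normr0.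
have [_ [y [dy y1 ->]] ylt] := sup_adherent Apos hsA.
exists n, y, (sup A); split=> //.
  by split; [apply: le_trans K1A; rewrite le_max lexx|apply: le_trans K1A; apply: le_trans K11].
by apply: ltW; apply: le_lt_trans ylt; rewrite {2}[sup A]splitr addrK.
Qed.

(* The coefficients exceeding [delta * alpha k] are few; the remaining ones     *)
(* contribute to [x l] a part which is disjoint in [l] and dominated by         *)
(* [delta *: \sum_k alpha k *: modulus (y k)].                                  *)
Lemma disjoint_combination_estimate n (x err : nat -> E) (K : R) (I : finType)
    (alpha : I -> R) (y : I -> E) (c : nat -> I -> R) (gamma D delta B N : R) :
  disjoint_family n x -> 0 <= K ->
  (forall z : nat -> E, disjoint_family n z ->
    \sum_(i < n) `|z i| <= K * `|\sum_(i < n) z i|) ->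
  0 <= delta -> 0 <= B -> 0 <= N ->
  (forall k, 0 <= alpha k) -> \sum_k alpha k * `|y k| <= D ->
  (forall (l : 'I_n) k, `|c l k| <= B * alpha k) ->
  (forall k, #|[pred l : 'I_n | delta * alpha k < `|c l k|]|%:R <= N) ->
  (forall l : 'I_n, gamma *: x l = \sum_k c l k *: y k + err l) ->
  `|gamma| * \sum_(l < n) `|x l| <=
    B * N * D + \sum_(l < n) `|err l| + K * delta * D.
Proof.
move=> dx K0 hK d0 B0 N0 a0 yD cB cN xE.
pose x' l := `|gamma| *: x l.
have dx' : disjoint_family n x' by exact: disjoint_familyZ.
pose small l := \sum_(k | ~~ (delta * alpha k < `|c l k|)) c l k *: y k.
pose big l := \sum_(k | delta * alpha k < `|c l k|) c l k *: y k.
(* The parts [small l] need not be disjoint; meeting them with the disjoint [x' l] makes them so,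
   and [hK] becomes applicable. *)
pose v l := rmeet (x' l) (modulus (small l)).
have v0 l : (l < n)%N -> 0 <=r v l.
  by move=> ln; apply: rmeet_ge0; [exact: dx'.1|exact: modulus_ge0].
have dv : disjoint_family n v.
  by apply: disjoint_family_le dx' v0 _ => l ln; exact: rmeet_lel.
pose Y := \sum_k alpha k *: modulus (y k).
have Y0 : 0 <=r Y.
  by apply: rsum_ge0 => k _; apply: rscaler_ge0 => //; exact: modulus_ge0.
have nY : `|Y| <= D.
  apply: le_trans yD; apply: (le_trans (ler_norm_sum _ _ _)).
  by apply: ler_sum => k _; rewrite normrZ norm_modulus ger0_norm.
have vY l : (l < n)%N -> v l <=r delta *: Y.
  move=> ln; apply: rle_trans (rmeet_ler _ _) _.
  apply: rle_trans (modulus_sum _ _ _) _.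
  rewrite /Y scaler_sumr [X in _ <=r X](bigID (fun k => ~~ (delta * alpha k < `|c l k|)))/=.
  apply: (@rle_trans _ _ (\sum_(k | ~~ (delta * alpha k < `|c l k|))
      delta *: (alpha k *: modulus (y k)))).
    apply: rler_sum => k; rewrite -leNgt => ck; rewrite modulusZ scalerA.
    by apply: rler_scale_le => //; exact: modulus_ge0.
  apply: rler_addl; apply: rsum_ge0 => k _; apply: rscaler_ge0 => //.
  by apply: rscaler_ge0 => //; exact: modulus_ge0.
have sv : \sum_(l < n) `|v l| <= K * delta * D.
  apply: (le_trans (hK _ dv)); rewrite -mulrA; apply: ler_wpM2l => //.
  apply: (@le_trans _ _ `|delta *: Y|); last by rewrite normrZ ger0_norm// ler_wpM2l.
  apply: ler_norm_pos; first by apply: rsum_ge0 => l _; exact: v0.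
  apply: rler_disjoint_sum dv.2 => //.
  exact: rscaler_ge0.
have sbig : \sum_(l < n) `|big l| <= B * N * D.
  apply: (@le_trans _ _ (\sum_(l < n) \sum_(k | delta * alpha k < `|c l k|)
      B * alpha k * `|y k|)).
    apply: ler_sum => l _; apply: (le_trans (ler_norm_sum _ _ _)).
    by apply: ler_sum => k _; rewrite normrZ ler_wpM2r.
  rewrite (exchange_big_dep predT)//=.
  apply: (@le_trans _ _ (\sum_k N * B * (alpha k * `|y k|))); last first.
    by rewrite -mulr_sumr [N * B]mulrC ler_wpM2l// mulr_ge0.
  apply: ler_sum => k _; rewrite sumr_const -[leLHS]mulr_natl -!mulrA.
  by apply: ler_wpM2r; [rewrite !mulr_ge0|exact: cN].
have nx (l : 'I_n) : `|x' l| <= `|v l| + `|big l| + `|err l|.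
  apply: (@le_trans _ _ `|v l + (modulus (big l) + modulus (err l))|); last first.
    rewrite -(norm_modulus (big l)) -(norm_modulus (err l)) -addrA.
    by apply: (le_trans (ler_normD _ _)); rewrite lerD2l ler_normD.
  have x'0 := dx'.1 l (ltn_ord l).
  apply: ler_norm_pos => //; rewrite /v rmeetD; apply: rmeet_glb.
    by apply: rler_addl; apply: raddr_ge0; exact: modulus_ge0.
  have -> : x' l = modulus (gamma *: x l).
    by rewrite modulusZ ger0_modulus//; exact: dx.1.
  rewrite xE (bigID (fun k => ~~ (delta * alpha k < `|c l k|)))/=.
  rewrite -[X in modulus X]addrA; apply: rle_trans (modulusD _ _) _.
  rewrite rle_add2l; apply: rle_trans (modulusD _ _) _; rewrite rle_add2r.
  rewrite /big; under [X in _ <=r modulus X]eq_bigl do rewrite -[_ < _]negbK.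
  exact: rle_refl.
have -> : `|gamma| * \sum_(l < n) `|x l| = \sum_(l < n) `|x' l|.
  by rewrite mulr_sumr; apply: eq_bigr => l _; rewrite normrZ normr_id.
apply: (le_trans (ler_sum _ (fun l _ => nx l))).
rewrite !big_split/= -addrA [leRHS]addrC.
by apply: lerD => //; rewrite lerD2r.
Qed.

End lower_estimates.

(** * Rademacher functions *)

Section rademacher.
Context (R : realType).

Definition sign_vector (n : nat) : Type := {ffun 'I_n -> bool}.

HB.instance Definition _ n := Finite.on (sign_vector n).

Definition rademacher n (l : 'I_n) (w : sign_vector n) : R := (-1) ^+ w l.

Lemma rademacher_norm n (l : 'I_n) w : `|rademacher l w| = 1.
Proof. by rewrite /rademacher normrX normrN1 expr1n. Qed.

Lemma rademacher_sqr n (l : 'I_n) w : rademacher l w * rademacher l w = 1.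
Proof. by rewrite /rademacher -signr_addb addbb. Qed.

Definition flip_sign n (l : 'I_n) (w : sign_vector n) : sign_vector n :=
  [ffun i => w i (+) (i == l)].

Lemma flip_signK n (l : 'I_n) : involutive (flip_sign l).
Proof. by move=> w; apply/ffunP => i; rewrite !ffunE -addbA addbb addbF. Qed.

Lemma sum_flip_sign n (l : 'I_n) (f : sign_vector n -> R) :
  (forall w, f (flip_sign l w) = - f w) -> \sum_w f w = 0.
Proof.
move=> fN; have : \sum_w f w = - \sum_w f w.
  rewrite {1}(reindex_inj (inv_inj (flip_signK l)))/= -sumrN.
  by apply: eq_bigr => w _; rewrite fN.
by move/eqP; rewrite -subr_eq0 opprK -mulr2n mulrn_eq0/= => /eqP.
Qed.

Lemma rademacher_flip n (l i : 'I_n) w :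
  rademacher i (flip_sign l w) = (-1) ^+ (i == l) * rademacher i w.
Proof. by rewrite /rademacher ffunE signr_addb mulrC. Qed.

Lemma sum_rademacher n (l : 'I_n) : \sum_w rademacher l w = 0.
Proof.
apply: (@sum_flip_sign _ l) => w.
by rewrite rademacher_flip eqxx expr1 mulN1r.
Qed.

Lemma sum_rademacherM n (l i : 'I_n) :
  \sum_w rademacher l w * rademacher i w = (l == i)%:R * #|{: sign_vector n}|%:R.
Proof.
have [->|li] := eqVneq l i.
  under eq_bigr do rewrite rademacher_sqr.
  by rewrite sumr_const mul1r.
rewrite mul0r; apply: (@sum_flip_sign _ l) => w.
by rewrite !rademacher_flip eqxx eq_sym (negbTE li) expr1 expr0 mul1r mulN1r mulNr.
Qed.

Lemma card_sign_vector_gt0 n : 0 < #|{: sign_vector n}|%:R :> R.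
Proof. by rewrite ltr0n; apply/card_gt0P; exists [ffun=> true]. Qed.

Context (p : R).
Hypothesis p1 : 1 < p.

(** Here [1 < p] matters: large values of a function bounded in [l_p] contribute little to its
    mean. *)
Lemma powR_superlinear (kappa : R) : 0 < kappa ->
  exists2 M : R, 1 <= M & forall b : R, M < b -> b <= kappa * b `^ p.
Proof.
move=> k0; pose M := Num.max 1 (kappa^-1 `^ (p - 1)^-1).
have q0 : 0 < p - 1 by rewrite subr_gt0.
exists M => [|b Mb]; first by rewrite le_max lexx.
have b0 : 0 < b by rewrite (lt_trans _ Mb)// lt_max ltr01.
have -> : b `^ p = b * b `^ (p - 1).
  by rewrite -{2}(@powRr1 _ b) ?ltW// -powRD ?subrKC//; apply/implyP => _; rewrite gt_eqF.
rewrite mulrCA ler_pMr// mulrC -ler_pdivrMr// mul1r.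
have kM : kappa^-1 `^ (p - 1)^-1 <= b.
  by apply: ltW; apply: le_lt_trans Mb; rewrite le_max lexx orbT.
have {1}-> : kappa^-1 = (kappa^-1 `^ (p - 1)^-1) `^ (p - 1).
  by rewrite -powRrM mulVf ?gt_eqF// powRr1// invr_ge0 ltW.
by apply: ge0_ler_powR => //; rewrite ?nnegrE ?powR_ge0// ltW.
Qed.

Lemma ler_1DpowR (b : R) : 0 <= b -> b <= 1 + b `^ p.
Proof.
move=> b0; have [b1|b1] := leP b 1; first by rewrite (le_trans b1)// lerDl powR_ge0.
have : b `^ 1 <= b `^ p by apply: ler_powR; apply: ltW.
by rewrite powRr1// => /le_trans; apply; rewrite lerDr.
Qed.

Lemma rademacher_coef_le n (l : 'I_n) (b : sign_vector n -> R) :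
  \sum_w `|b w| `^ p <= #|{: sign_vector n}|%:R ->
  `|\sum_w rademacher l w * b w| <= 2 * #|{: sign_vector n}|%:R.
Proof.
move=> bp; apply: (le_trans (ler_norm_sum _ _ _)).
apply: (@le_trans _ _ (\sum_w (1 + `|b w| `^ p))).
  by apply: ler_sum => w _; rewrite normrM rademacher_norm mul1r ler_1DpowR.
by rewrite big_split/= sumr_const mulr_natl mulr2n lerD2l.
Qed.

(* A dual Khintchine inequality, in weak form: the pairing of [b] with a sum    *)
(* [g] of [k] signed Rademacher functions is small compared with [k] when [k]   *)
(* is large, since [g] is of order [sqrt k] in mean square.                     *)
Lemma rademacher_large_coefs (delta : R) : 0 < delta ->
  exists2 N : R, 0 <= N & forall n (b : sign_vector n -> R),
    \sum_w `|b w| `^ p <= #|{: sign_vector n}|%:R ->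
    #|[pred l : 'I_n | delta * #|{: sign_vector n}|%:R
        < `|\sum_w rademacher l w * b w|]|%:R <= N.
Proof.
move=> d0; have k0 : 0 < delta / 4 by rewrite divr_gt0.
have [M M1 bM] := powR_superlinear k0.
have M0 : 0 < M by exact: lt_le_trans M1.
have N0 : 0 <= 8 * M ^+ 2 / delta ^+ 2.
  by apply: divr_ge0; [apply: mulr_ge0 => //|]; apply: exprn_ge0; exact: ltW.
exists (8 * M ^+ 2 / delta ^+ 2) => //.
move=> n b bp; set m : R := #|{: sign_vector n}|%:R in bp *.
have m0 : 0 < m by exact: card_sign_vector_gt0.
pose c l := \sum_w rademacher l w * b w.
pose I := [pred l : 'I_n | delta * m < `|c l|].
set k : R := #|I|%:R; have [k00|kp] := leP k 0.
  exact: le_trans k00 N0.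
(* The signs are chosen so that pairing [g] with [b] adds up the absolute values of the large
   coefficients. *)
pose g w := \sum_(l in I) Num.sg (c l) * rademacher l w.
have gk w : `|g w| <= k.
  apply: (le_trans (ler_norm_sum _ _ _)); rewrite /k -sumr_const.
  apply: ler_sum => l _; rewrite normrM rademacher_norm mulr1.
  by rewrite normr_sg lern1 leq_b1.
have g2 : \sum_w g w ^+ 2 <= k * m.
  under eq_bigr do rewrite expr2 /g big_distrl/=.
  rewrite exchange_big/= /k -sumr_const big_distrl/=; apply: ler_sum => l lI.
  under eq_bigr do rewrite big_distrr/=.
  rewrite exchange_big/= (bigD1 l)//= [X in _ + X]big1 ?addr0.
    under eq_bigr do rewrite mulrACA.
    rewrite -big_distrr/= sum_rademacherM eqxx mul1r ler_piMl ?(ltW m0)//.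
    by rewrite -expr2 sqr_sg lern1 leq_b1.
  move=> i /andP[_ il]; under eq_bigr do rewrite mulrACA.
  by rewrite -big_distrr/= sum_rademacherM eq_sym (negbTE il) mul0r mulr0.
have low : delta * m * k <= \sum_w g w * b w.
  have -> : \sum_w g w * b w = \sum_(l in I) `|c l|.
    under eq_bigr do rewrite /g big_distrl/=.
    rewrite exchange_big/=; apply: eq_bigr => l _.
    rewrite normrEsg /c big_distrr/=.
    by apply: eq_bigr => w _; rewrite mulrA.
  rewrite /k -sumr_const big_distrr/=; apply: ler_sum => l lI.
  by rewrite mulr1 ltW.
(* With this threshold [M * t] is [delta / 4 * k], so that the terms linear in [k] in the upper
   bound amount to half of the lower bound [delta * k], and [M * k / t] does not depend on [k]. *)
pose t := delta / (4 * M) * k.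
have t0 : 0 < t by rewrite mulr_gt0// divr_gt0// mulr_gt0.
(* Where [b] exceeds [M] in absolute value, [g] is bounded by [k] and superlinearity is used;
   elsewhere [b] is bounded by [M], and [g] is either at most [t] or at most [g w ^+ 2 / t] in
   absolute value. *)
have pt w : g w * b w <= k * (delta / 4 * `|b w| `^ p) + M * (t + g w ^+ 2 / t).
  have h1 : 0 <= M * (t + g w ^+ 2 / t).
    by rewrite mulr_ge0 ?addr_ge0 ?divr_ge0 ?sqr_ge0// ltW.
  have h2 : 0 <= k * (delta / 4 * `|b w| `^ p).
    by rewrite !mulr_ge0 ?powR_ge0// ltW.
  apply: (le_trans (ler_norm _)); rewrite normrM; have [Mb|Mb] := ltP M `|b w|.
    apply: (@le_trans _ _ (k * `|b w|)); first by rewrite ler_wpM2r.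
    apply: (@le_trans _ _ (k * (delta / 4 * `|b w| `^ p))); last by rewrite lerDl.
    by apply: ler_wpM2l; [exact: ltW|exact: bM].
  apply: (@le_trans _ _ (M * `|g w|)); first by rewrite mulrC ler_wpM2r.
  apply: (@le_trans _ _ (M * (t + g w ^+ 2 / t))); last by rewrite lerDr.
  rewrite ler_wpM2l ?(ltW M0)//; have [gt|gt] := leP `|g w| t.
    by rewrite (le_trans gt)// lerDl divr_ge0 ?sqr_ge0// ltW.
  apply: (@le_trans _ _ (g w ^+ 2 / t)); last by rewrite lerDr ltW.
  by rewrite ler_pdivlMr// -real_normK ?num_real// expr2 ler_wpM2l// ltW.
have up : \sum_w g w * b w <=
    k * (delta / 4 * m) + M * (t * m + k * m / t).
  apply: (le_trans (ler_sum _ (fun w _ => pt w))).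
  rewrite big_split/= -!big_distrr/= big_split/= sumr_const -big_distrl/=.
  apply: lerD.
    by rewrite ler_wpM2l ?(ltW kp)// ler_wpM2l// ltW.
  rewrite ler_wpM2l ?(ltW M0)// -[t *+ _]mulr_natr lerD2l.
  by rewrite ler_wpM2r// invr_ge0 ltW.
have := le_trans low up.
have -> : k * (delta / 4 * m) + M * (t * m + k * m / t) =
    (k * delta / 2 + 4 * M ^+ 2 / delta) * m.
  by rewrite /t; field; rewrite !gt_eqF.
rewrite mulrAC ler_pM2r// => fin.
rewrite ler_pdivlMr ?exprn_gt0//.
have : delta * (delta * k) <= delta * (k * delta / 2 + 4 * M ^+ 2 / delta).
  by rewrite ler_pM2l.
have -> : delta * (k * delta / 2 + 4 * M ^+ 2 / delta) =
  delta ^+ 2 * k / 2 + 4 * M ^+ 2 by field; rewrite gt_eqF.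
by rewrite expr2; lra.
Qed.

Lemma rademacher_large_coefs_scaled (delta : R) : 0 < delta ->
  exists2 N : R, 0 <= N & forall n (b : sign_vector n -> R) (a : R), 0 <= a ->
    \sum_w `|b w| `^ p <= a `^ p * #|{: sign_vector n}|%:R ->
    #|[pred l : 'I_n | delta * a * #|{: sign_vector n}|%:R
        < `|\sum_w rademacher l w * b w|]|%:R <= N /\
    forall l, `|\sum_w rademacher l w * b w| <= 2 * a * #|{: sign_vector n}|%:R.
Proof.
move=> d0; have [N N0 hN] := rademacher_large_coefs d0; exists N => // n b a a0 bp.
have pp : 0 < p by exact: lt_trans p1.
move: a0; rewrite le_eqVlt => /predU1P[a00|a0].
  have b0 w : b w = 0.
    apply/eqP; rewrite -normr_le0 leNgt; apply/negP => bw.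
    have : `|b w| `^ p <= 0.
      apply: le_trans (_ : \sum_w `|b w| `^ p <= 0).
        by rewrite (bigD1 w)//= lerDl sumr_ge0// => *; exact: powR_ge0.
      by apply: (le_trans bp); rewrite -a00 powR0 ?gt_eqF// mul0r.
    by rewrite leNgt powR_gt0.
  have c0 l : \sum_w rademacher l w * b w = 0 :> R by rewrite big1// => w _; rewrite b0 mulr0.
  split; last by move=> l; rewrite c0 -a00 normr0 mulr0 mul0r.
  by rewrite eq_card0// => l; rewrite !inE c0 -a00 normr0 mulr0 mul0r ltxx.
pose b' w := a^-1 * b w.
have bp' : \sum_w `|b' w| `^ p <= #|{: sign_vector n}|%:R.
  rewrite /b'; under eq_bigr do rewrite normrM powRM// ger0_norm ?invr_ge0 ?(ltW a0)//.
  rewrite -big_distrr/= -(@ler_pM2l _ (a `^ p)) ?powR_gt0// mulrA -powRM ?invr_ge0 ?(ltW a0)//.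
  by rewrite divff ?gt_eqF// powR1 mul1r.
have cE l : \sum_w rademacher l w * b w = a * \sum_w rademacher l w * b' w.
  rewrite big_distrr/=; apply: eq_bigr => w _.
  by rewrite /b' [RHS]mulrCA [a * _]mulrA divff ?gt_eqF// mul1r.
split=> [|l].
  apply: le_trans (hN n b' bp'); rewrite ler_nat subset_leq_card//.
  apply/fintype.subsetP => l; rewrite !inE cE normrM (gtr0_norm a0).
  by rewrite [delta * a]mulrC -mulrA ltr_pM2l.
rewrite cE normrM (gtr0_norm a0) [2 * a]mulrC -mulrA ler_pM2l//.
exact: rademacher_coef_le.
Qed.

End rademacher.

(** * Positive projective tensor products *)

Section complete_spaces.
Context (R : realType).

(** The limit inherits the explicit rate, which is what the later approximations quote. *)
Lemma rate_cvg (Z : completeNormedModType R) (z : nat -> Z) (r : nat -> R) :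
  (forall m n, (m <= n)%N -> `|z m - z n| <= r m) ->
  (forall e, 0 < e -> exists m, r m < e) ->
  exists l, forall m, `|z m - l| <= r m.
Proof.
move=> zr r0.
have cz : cauchy (z @ \oo).
  apply/cauchyP => e e0; have [m rm] := r0 _ e0; exists (z m).
  exists m => // n /= mn; rewrite -ball_normE /=.
  exact: le_lt_trans (zr _ _ mn) rm.
have /cvg_ex[l zl] : cvg (z @ \oo) by exact: (@cauchy_cvg Z (z @ \oo) _ cz).
exists l => m; apply/ler_addgt0Pr => e e0.
have [N _ hN] := (cvgrPdist_lt _ _).1 zl _ e0.
pose n := maxn m N.
apply: (le_trans (ler_distD (z n) _ _)); apply: lerD.
  by apply: zr; exact: leq_maxl.
by rewrite distrC ltW//; apply: hN; exact: leq_maxr.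
Qed.

Lemma dense_approx (T : Type) (X : normedModType R) (j : T -> X) (u : X) (e : R) :
  dense (range j) -> 0 < e -> exists g, `|u - j g| < e.
Proof.
move=> dj e0; have [] := dj (ball u e).
- by exists u; exact: ballxx.
- exact: ball_open.
by move=> x [ug [g _ gx]]; exists g; rewrite gx; rewrite -ball_normE in ug.
Qed.

(** The single inequality says both that [Phi] extends [f] (take [u = j g]) and how well [f g]
    approximates [Phi u]; algebraic identities for [Phi] follow from it without a separate
    continuity statement. *)
Lemma dense_contraction_extension (T : Type) (X : normedModType R)
    (Z : completeNormedModType R) (j : T -> X) (f : T -> Z) :
  dense (range j) -> (forall g h, `|f g - f h| <= `|j g - j h|) ->
  exists Phi : X -> Z, forall u g, `|Phi u - f g| <= `|u - j g|.
Proof.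
move=> dj fj.
suff /choice[Phi hPhi] : forall u, exists z, forall g, `|z - f g| <= `|u - j g| by exists Phi.
move=> u.
have /choice[g gu] : forall n : nat, exists g, `|u - j g| < n.+1%:R^-1.
  by move=> n; exact: dense_approx.
have small (e : R) : 0 < e -> exists m, m.+1%:R^-1 < e.
  move=> e0; have := near_infty_natSinv_lt (PosNum e0) => -[N _ hN].
  by exists N; exact: (hN N (leqnn N)).
have [||l hl] := @rate_cvg Z (f \o g) (fun m => 2 * m.+1%:R^-1).
- move=> m n mn /=; apply: (le_trans (fj _ _)).
  apply: (le_trans (ler_distD u _ _)); rewrite mulr_natl mulr2n; apply: lerD.
    by rewrite distrC ltW.
  by apply: (le_trans (ltW (gu n))); rewrite lef_pV2 ?posrE// ler_nat.
- move=> e e0; have [m hm] := small (e / 2) (divr_gt0 e0 (ltr0Sn _ 1)).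
  by exists m; rewrite mulrC -ltr_pdivlMr.
exists l => h; apply/ler_addgt0Pr => e e0.
have [m hm] := small (e / 3) (divr_gt0 e0 (ltr0Sn _ 2)).
apply: (le_trans (ler_distD (f (g m)) _ _)).
have h1 := hl m; rewrite /= distrC in h1.
have h2 := le_trans (fj (g m) h) (ler_distD u _ _).
rewrite (distrC (j (g m)) u) in h2.
have h3 := gu m.
move: h1 h2 h3 hm; set a := m.+1%:R^-1 => *; lra.
Qed.

End complete_spaces.

Section positive_tensor.
Context (R : realType) (X Y : banachLatticeType R).

Lemma ppn_lbound (G : rieszType R) (t : X -> Y -> G) (u : G) :
  has_lbound [set r : R | exists (n : nat) (x : 'I_n -> X) (y : 'I_n -> Y),
    [/\ forall i, 0 <=r x i, forall i, 0 <=r y i,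
        modulus u <=r \sum_i t (x i) (y i)
      & r = \sum_i `|x i| * `|y i|]].
Proof.
exists 0 => _ [n [x [y [_ _ _ ->]]]].
by apply: sumr_ge0 => i _; exact: mulr_ge0.
Qed.

(* If [u] had no dominating sum of elementary tensors then the infimum of the   *)
(* empty set being [0] would force [u = 0].                                     *)
Lemma riesz_hom_ler_ppn (G : rieszType R) (t : X -> Y -> G)
    (F Z : banachLatticeType R) (j : G -> F) (f : G -> Z) :
  riesz_hom j -> injective j ->
  (forall u, `|j u| = positive_projective_norm t u) ->
  riesz_hom f ->
  (forall x y, 0 <=r x -> 0 <=r y -> `|f (t x y)| <= `|x| * `|y|) ->
  forall u, `|f u| <= `|j u|.
Proof.
move=> hj inj jE hf fxy u; rewrite jE /positive_projective_norm.
set A := [set r | _]; have [[r0 Ar0]|A0] := pselect (A !=set0); last first.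
  have /normr0_eq0 ju0 : `|j u| = 0.
    rewrite jE /positive_projective_norm -/A.
    have -> : A = set0 by apply: contrapT => /eqP/set0P.
    exact: inf0.
  have -> : u = 0 by apply: inj; rewrite ju0 riesz_hom0.
  rewrite riesz_hom0// normr0.
  by rewrite [X in inf X](_ : _ = set0) ?inf0//; apply: contrapT => /eqP/set0P.
apply: lb_le_inf; first by exists r0.
move=> _ [n [x [y [x0 y0 uxy ->]]]].
rewrite -norm_modulus -riesz_hom_modulus//.
apply: (@le_trans _ _ `|f (\sum_i t (x i) (y i))|).
  apply: ler_norm_pos; last exact: riesz_hom_le.
  by apply: riesz_hom_ge0 => //; exact: modulus_ge0.
rewrite riesz_hom_sum//; apply: (le_trans (ler_norm_sum _ _ _)).
by apply: ler_sum => i _; exact: fxy.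
Qed.

Context (F : banachLatticeType R) (tF : X -> Y -> F).
Hypothesis hF : is_positive_projective_tensor tF.

Lemma ppt_bimorphism : riesz_bimorphism tF.
Proof.
have [G [t [j [[_ [[tl tr] tpl tpr] _ _ _] [hj _] _ _ tE]]]] := hF.
have hj1 := hj.1; have hj2 := hj.2.
split.
- split=> [v|u] a x y.
    by rewrite !tE tl hj1.
  by rewrite !tE tr hj1.
- move=> v v0; have [l m] := tpl _ v0; split=> [a x y|x y].
    by rewrite !tE l hj1.
  by rewrite !tE m hj2.
- move=> u u0; have [l m] := tpr _ u0; split=> [a x y|x y].
    by rewrite !tE l hj1.
  by rewrite !tE m hj2.
Qed.

Lemma ppt_norm_le x y : 0 <=r x -> 0 <=r y -> `|tF x y| <= `|x| * `|y|.
Proof.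
have [G [t [j [[_ [_ tpl tpr] _ _ _] _ jE _ tE]]]] := hF.
move=> x0 y0; rewrite tE jE; apply: ge_inf; first exact: ppn_lbound.
exists 1%N, (fun=> x), (fun=> y); rewrite !big_ord1; split=> //.
rewrite ger0_modulus; first exact: rle_refl.
exact: riesz_hom_ge0 (tpl _ y0) x0.
Qed.

(** The universal property yields a Riesz homomorphism on Fremlin's tensor product;
    [riesz_hom_ler_ppn] makes it a contraction, and it extends by density. *)
Lemma ppt_extension (Z : banachLatticeType R) (b : X -> Y -> Z) :
  riesz_bimorphism b ->
  (forall x y, 0 <=r x -> 0 <=r y -> `|b x y| <= `|x| * `|y|) ->
  exists Phi : F -> Z, [/\ riesz_hom Phi, forall u, `|Phi u| <= `|u|
    & forall x y, Phi (tF x y) = b x y].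
Proof.
move=> hb bxy.
have [G [t [j [[_ _ _ _ univ] [hj inj] jE dj tE]]]] := hF.
have [f [hf fE _]] := univ Z b (@banach_archimedean R Z) hb.
have fj : forall u, `|f u| <= `|j u|.
  apply: (riesz_hom_ler_ppn hj inj jE hf) => x y x0 y0.
  by rewrite fE; exact: bxy.
have fjB g h : `|f g - f h| <= `|j g - j h|.
  by rewrite -!riesz_homB.
have [Phi hPhi] := dense_contraction_extension dj fjB.
have PhiE g : Phi (j g) = f g.
  by apply/eqP; rewrite -subr_eq0 -normr_le0 (le_trans (hPhi _ g))// subrr normr0.
(* Linearity and preservation of joins hold for [f]; they pass to [Phi] with an error bounded by a
   fixed multiple of any [e]. *)
have eq0 (z : Z) (C : R) : 0 <= C -> (forall e, 0 < e -> `|z| <= C * e) -> z = 0.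
  move=> C0 ze; apply/eqP; rewrite -normr_le0; apply/ler_addgt0Pr => e e0.
  rewrite add0r; have C1 : 0 < C + 1 by rewrite ltr_wpDl.
  apply: (le_trans (ze (e / (C + 1)) (divr_gt0 e0 C1))).
  by rewrite mulrCA ler_piMr ?(ltW e0)// ler_pdivrMr// mul1r ltW// ltrDl.
exists Phi; split; last by move=> x y; rewrite tE PhiE fE.
- split=> [a x y|x y].
    apply/eqP; rewrite -subr_eq0; apply/eqP.
    apply: (eq0 _ (2 * `|a| + 2)); first by rewrite addr_ge0// mulr_ge0.
    move=> e e0; have [g xg] := dense_approx x dj e0.
    have [h yh] := dense_approx y dj e0.
    have -> : Phi (a *: x + y) - (a *: Phi x + Phi y) =
      (Phi (a *: x + y) - f (a *: g + h)) - (a *: (Phi x - f g) + (Phi y - f h)).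
      by rewrite hf.1 scalerBr addrACA -opprD opprB addrA subrK.
    apply: (le_trans (ler_normB _ _)).
    have h1 : `|Phi (a *: x + y) - f (a *: g + h)| <= `|a| * e + e.
      apply: (le_trans (hPhi _ _)); rewrite hj.1 opprD addrACA -scalerBr.
      apply: (le_trans (ler_normD _ _)); rewrite normrZ; apply: lerD; last exact: ltW.
      by rewrite ler_wpM2l// ltW.
    have h2 : `|a *: (Phi x - f g) + (Phi y - f h)| <= `|a| * e + e.
      apply: (le_trans (ler_normD _ _)); rewrite normrZ; apply: lerD.
        by rewrite ler_wpM2l// (le_trans (hPhi _ _))// ltW.
      by rewrite (le_trans (hPhi _ _))// ltW.
    apply: (le_trans (lerD h1 h2)).
    by rewrite (_ : (2 * `|a| + 2) * e = `|a| * e + e + (`|a| * e + e))//; ring.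
  apply/eqP; rewrite -subr_eq0; apply/eqP.
  apply: (eq0 _ 4) => // e e0; have [g xg] := dense_approx x dj e0.
  have [h yh] := dense_approx y dj e0.
  apply: (le_trans (ler_distD (f (rjoin g h)) _ _)).
  have h1 : `|Phi (rjoin x y) - f (rjoin g h)| <= e + e.
    apply: (le_trans (hPhi _ _)); rewrite hj.2; apply: (le_trans (norm_rjoinB _ _ _ _)).
    by apply: lerD; exact: ltW.
  have h2 : `|f (rjoin g h) - rjoin (Phi x) (Phi y)| <= e + e.
    rewrite hf.2 distrC; apply: (le_trans (norm_rjoinB _ _ _ _)).
    by apply: lerD; rewrite (le_trans (hPhi _ _))// ltW.
  lra.
- by move=> u; have := hPhi u 0; rewrite (riesz_hom0 hf) (riesz_hom0 hj) !subr0.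
Qed.

(** The positive projective norm is determined by positive elementary tensors, so the bound on them
    improves the crude constant [C] to 1 on a dense subspace; [C] itself only serves to pass to the
    completion. *)
Lemma ppt_riesz_hom_contraction (Z : banachLatticeType R) (Phi : F -> Z) (C : R) :
  riesz_hom Phi -> 0 <= C -> (forall u, `|Phi u| <= C * `|u|) ->
  (forall x y, 0 <=r x -> 0 <=r y -> `|Phi (tF x y)| <= `|x| * `|y|) ->
  forall u, `|Phi u| <= `|u|.
Proof.
move=> hPhi C0 PhiC Phixy u.
have [G [t [j [_ [hj inj] jE dj tE]]]] := hF.
have hPj : riesz_hom (Phi \o j).
  split=> [a x y|x y] /=; first by rewrite hj.1 hPhi.1.
  by rewrite hj.2 hPhi.2.
have Pj : forall g, `|Phi (j g)| <= `|j g|.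
  by apply: (riesz_hom_ler_ppn hj inj jE hPj) => x y; rewrite /= -tE; exact: Phixy.
apply/ler_addgt0Pr => e e0; have C1 : 0 < C + 1 by rewrite ltr_wpDl.
have [g ug] := dense_approx u dj (divr_gt0 e0 C1).
rewrite -(subrK (j g) u) riesz_homD//; apply: (le_trans (ler_normD _ _)).
have h1 := PhiC (u - j g); have h2 := Pj g.
have h3 : `|j g| <= `|u - j g + j g| + `|u - j g|.
  by rewrite subrK -{1}(subKr u (j g)) ler_normB.
rewrite ltr_pdivlMr// in ug; nra.
Qed.

End positive_tensor.

(** * Coordinates of l_p tensor products *)

Section bilinear_theory.
Context (R : realType) (U V W : lmodType R) (b : U -> V -> W).
Hypothesis hb : is_bilinear b.

Lemma bilinear_suml (I : Type) (s : seq I) (P : pred I) (x : I -> U) v :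
  b (\sum_(i <- s | P i) x i) v = \sum_(i <- s | P i) b (x i) v.
Proof.
have [g gE] := linear_packed (hb.1 v).
have bE u : b u v = g u by rewrite -gE.
by rewrite bE linear_sum; apply: eq_bigr => i _; rewrite bE.
Qed.

Lemma bilinearZl a u v : b (a *: u) v = a *: b u v.
Proof.
have [g gE] := linear_packed (hb.1 v).
have bE x : b x v = g x by rewrite -gE.
by rewrite !bE linearZ.
Qed.

Lemma bilinearZr a u v : b u (a *: v) = a *: b u v.
Proof. by have [g ->] := linear_packed (hb.2 u); rewrite linearZ. Qed.

End bilinear_theory.

Section ell_theory.
Context (R : realType) (p : R) (p1 : 1 <= p).

Let p0 : 0 < p. Proof. exact: lt_le_trans p1. Qed.

Lemma ell_sum_le (x : nat -> R) (M : R) :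
  (forall n, \sum_(k < n) `|x k| `^ p <= M) -> (ell_sum p x <= M%:E)%E.
Proof.
rewrite ell_sum.unlock => h; apply: lime_le.
  by apply: is_cvg_nneseries => k _ _; rewrite lee_fin powR_ge0.
by apply: nearW => n /=; rewrite sumEFin lee_fin big_mkord.
Qed.

Lemma ell_partial_sum_le (x : ell p1) n : \sum_(k < n) `|x k| `^ p <= `|x| `^ p.
Proof.
rewrite -lee_fin -[X in (_ <= X)%E](ell_sum_norm x) ell_sum.unlock.
rewrite -(big_mkord predT (fun k => `|x k| `^ p)) -sumEFin.
by apply: nneseries_lim_ge => k _ _; rewrite lee_fin powR_ge0.
Qed.

(** Double counting of the pairs [(k, w)] with [iota w = k]. *)
Lemma sum_ord_inj (I : finType) (iota : I -> nat) (f : nat -> R) n :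
  \sum_(k < n) f k * #|[pred w | iota w == k]|%:R =
  \sum_(w | (iota w < n)%N) f (iota w).
Proof.
transitivity (\sum_(k < n) \sum_(w | iota w == k) f k).
  by apply: eq_bigr => k _; rewrite sumr_const mulr_natr.
rewrite (exchange_big_dep (fun w => (iota w < n)%N))/=; last first.
  by move=> k w _ /eqP ->.
apply: eq_bigr => w wn; rewrite (bigD1 (Ordinal wn))//= big1 ?addr0// => k.
by rewrite -val_eqE/= eq_sym => /andP[/eqP ->]; rewrite eqxx.
Qed.

Lemma card_fiber_inj (I : finType) (iota : I -> nat) k : injective iota ->
  (#|[pred w | iota w == k]| <= 1)%N.
Proof.
move=> inj; apply/card_le1_eqP => u v; rewrite !inE => /eqP <- /eqP.
by move/inj.
Qed.

Lemma ell_sum_inj_le (I : finType) (iota : I -> nat) (x : ell p1) : injective iota ->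
  \sum_w `|x (iota w)| `^ p <= `|x| `^ p.
Proof.
move=> inj; pose n := (\max_w iota w).+1.
apply: le_trans (ell_partial_sum_le x n).
have -> : \sum_w `|x (iota w)| `^ p = \sum_(w | (iota w < n)%N) `|x (iota w)| `^ p.
  by apply: eq_bigl => w; rewrite ltnS leq_bigmax.
rewrite -(sum_ord_inj iota (fun k => `|x k| `^ p)); apply: ler_sum => k _.
by rewrite ler_piMr ?powR_ge0// lern1 card_fiber_inj.
Qed.

Lemma ell_unit_subproof i : (fun k => (k == i)%:R) \in ell_pred p1.
Proof.
rewrite inE; apply: (@le_lt_trans _ _ 1%:E); last exact: ltry.
apply: ell_sum_le => n.
apply: (@le_trans _ _ (\sum_(k < n) 1 * #|[pred w : unit | i == k]|%:R)).
  apply: ler_sum => k _; rewrite mul1r eq_sym; case: (i == k :> nat).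
    by rewrite normr1 powR1 ler1n; apply/card_gt0P; exists tt.
  by rewrite normr0 powR0 ?gt_eqF.
rewrite (sum_ord_inj (fun _ : unit => i) (fun=> 1)).
apply: (@le_trans _ _ (\sum_(w : unit) 1)); last by rewrite sumr_const card_unit.
by rewrite [leRHS](bigID (fun=> (i < n)%N))/= lerDl sumr_ge0.
Qed.

Definition ell_unit i : ell p1 := Ell (ell_unit_subproof i).

Lemma ell_coord_sum (I : Type) (s : seq I) (P : pred I) (x : I -> ell p1) k :
  (\sum_(i <- s | P i) x i) k = \sum_(i <- s | P i) x i k.
Proof. exact: (big_morph (fun y : ell p1 => y k)). Qed.

Lemma ell_modulus (x : ell p1) k : modulus x k = `|x k|.
Proof.
have -> : modulus x k = Num.max (x k) (- x k) by [].
by rewrite maxrN.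
Qed.

Lemma ell_norm_units_le (I : finType) (iota : I -> nat) : injective iota ->
  `|\sum_w ell_unit (iota w)| <= #|I|%:R `^ p^-1.
Proof.
move=> inj; set x := \sum_w _.
change (ell_norm x <= #|I|%:R `^ p^-1).
rewrite ell_norm_le ?powR_ge0// -powRrM mulVf ?gt_eqF// powRr1//.
apply: ell_sum_le => n.
apply: (@le_trans _ _ (\sum_(k < n) 1 * #|[pred w | iota w == k]|%:R)).
  apply: ler_sum => k _; rewrite mul1r.
  have -> : x k = #|[pred w | iota w == k]|%:R.
    rewrite ell_coord_sum -sum1_card natr_sum big_mkcond/= [RHS]big_mkcond/=.
    apply: eq_bigr => w _; rewrite inE eq_sym.
    by case: (iota w == k).
  have := card_fiber_inj k inj; case: #|_| => [|[|//]] _.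
    by rewrite normr0 powR0 ?gt_eqF.
  by rewrite normr1 powR1.
rewrite (sum_ord_inj iota (fun=> 1)).
apply: (@le_trans _ _ (\sum_(w : I) 1)); last by rewrite sumr_const.
by rewrite [leRHS](bigID (fun w => (iota w < n)%N))/= lerDl sumr_ge0.
Qed.

Lemma ell_trunc_coord (x : ell p1) n k :
  (\sum_(i < n) x i *: ell_unit i) k = if (k < n)%N then x k else 0.
Proof.
rewrite ell_coord_sum; case: ltnP => kn.
  rewrite (bigD1 (Ordinal kn))//= big1 ?addr0.
    by rewrite -[LHS]/(x k * (k == k)%:R) eqxx mulr1.
  move=> i ik; rewrite -[LHS]/(x i * (k == i)%:R).
  by move: ik; rewrite -val_eqE/= eq_sym => /negbTE ->; rewrite mulr0.
rewrite big1// => i _; rewrite -[LHS]/(x i * (k == i)%:R).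
by rewrite gtn_eqF ?mulr0// (leq_trans _ kn).
Qed.

Lemma ell_trunc_norm_le (x : ell p1) n : `|\sum_(i < n) x i *: ell_unit i| <= `|x|.
Proof.
apply: ler_norm_modulus => k; rewrite !ell_modulus ell_trunc_coord.
by case: ifP => _ //; rewrite normr0.
Qed.

Lemma ell_unit_ge0 i : 0 <=r ell_unit i.
Proof. by move=> k; exact: ler0n. Qed.

Lemma ell_unit_disjoint i j : i != j -> rmeet (ell_unit i) (ell_unit j) = 0.
Proof.
move=> ij; apply/val_inj/funext => k.
have -> : val (rmeet (ell_unit i) (ell_unit j)) k =
  - Num.max (- (k == i)%:R) (- (k == j)%:R) by [].
have -> : val (0 : ell p1) k = 0 by [].
have [->|ki] := eqVneq k i; first by rewrite (negbTE ij) oppr0 max_r ?oppr0// oppr_le0.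
by rewrite oppr0 max_l ?oppr0// oppr_le0.
Qed.

End ell_theory.

Section coordinates.
Context (R : realType) (p : R) (p1 : 1 <= p) (E F : banachLatticeType R).
Context (tF : ell p1 -> E -> F).
Hypothesis hF : is_positive_projective_tensor tF.

(** [J i] extends the contractive Riesz bimorphism sending [(t, x)] to [t i *: x]. *)
Lemma ppt_coordinates : exists J : nat -> F -> E,
  [/\ forall i, riesz_hom (J i), forall i u, `|J i u| <= `|u|
    & forall i t x, J i (tF t x) = t i *: x].
Proof.
have /choice[J hJ] : forall i, exists Phi : F -> E,
    [/\ riesz_hom Phi, forall u, `|Phi u| <= `|u|
      & forall (t : ell p1) x, Phi (tF t x) = t i *: x].
  move=> i; apply: (ppt_extension hF); last first.
    by move=> t x _ _; rewrite normrZ ler_wpM2r//; exact: ell_coord_le.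
  split.
  - split=> [v|u] a x y; last by rewrite scalerDr !scalerA mulrC.
    by rewrite scalerA -scalerDl.
  - move=> v v0; split=> [a x y|x y]; first by rewrite scalerA -scalerDl.
    by rewrite rjoinZl.
  - move=> u u0; split=> [a x y|x y]; first by rewrite scalerDr !scalerA mulrC.
    by rewrite rjoinZ//; exact: u0.
by exists J; split=> i; have [] := hJ i.
Qed.

Context (J : nat -> F -> E).
Hypotheses (J_hom : forall i, riesz_hom (J i)) (J_norm : forall i u, `|J i u| <= `|u|).
Hypothesis J_tensor : forall i t x, J i (tF t x) = t i *: x.

Let tbim : riesz_bimorphism tF := ppt_bimorphism hF.
Let tbil : is_bilinear tF. Proof. by case: tbim. Qed.

Lemma ppt_unit_riesz_hom i : riesz_hom (tF (ell_unit p1 i)).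
Proof. by have [_ _ h] := tbim; apply: h; exact: ell_unit_ge0. Qed.

Lemma ppt_ge0 t x : 0 <=r t -> 0 <=r x -> 0 <=r tF t x.
Proof. by have [_ _ h] := tbim; move=> t0; exact: riesz_hom_ge0 (h _ t0). Qed.

Lemma ppt_unit_norm_le i x : `|tF (ell_unit p1 i) x| <= `|ell_unit p1 i| * `|x|.
Proof.
rewrite -[X in X <= _]norm_modulus -(riesz_hom_modulus _ (ppt_unit_riesz_hom i)).
rewrite -(norm_modulus x); apply: (ppt_norm_le hF); first exact: ell_unit_ge0.
exact: modulus_ge0.
Qed.

Lemma ppt_unit_disjoint i j x y : i != j -> 0 <=r x -> 0 <=r y ->
  rmeet (tF (ell_unit p1 i) x) (tF (ell_unit p1 j) y) = 0.
Proof.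
move=> ij x0 y0; have [_ h _] := tbim.
have h' := h (x + y) (raddr_ge0 x0 y0).
apply: (@rmeet_disjoint_le _ _ _ _ (tF (ell_unit p1 i) (x + y)) (tF (ell_unit p1 j) (x + y))).
- by apply: ppt_ge0 => //; exact: ell_unit_ge0.
- by apply: ppt_ge0 => //; exact: ell_unit_ge0.
- by apply: riesz_hom_le; [exact: ppt_unit_riesz_hom|exact: rler_addl].
- by apply: riesz_hom_le; [exact: ppt_unit_riesz_hom|exact: rler_addr].
- have := riesz_hom_meet (ell_unit p1 i) (ell_unit p1 j) h' => /= <-.
  by rewrite ell_unit_disjoint// (riesz_hom0 h').
Qed.

Definition ppt_trunc n (u : F) : F := \sum_(i < n) tF (ell_unit p1 i) (J i u).

Lemma ppt_truncS n u :
  ppt_trunc n.+1 u = ppt_trunc n u + tF (ell_unit p1 n) (J n u).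
Proof. by rewrite /ppt_trunc big_ord_recr. Qed.

(** Distinct units embed [E] into mutually disjoint parts of [F], so the summands combine by
    [riesz_hom_disjointD]. *)
Lemma ppt_trunc_riesz_hom n : riesz_hom (ppt_trunc n).
Proof.
elim: n => [|n IHn].
  have -> : ppt_trunc 0 = fun=> 0 by apply/funext => u; rewrite /ppt_trunc big_ord0.
  split=> [a x y|x y]; first by rewrite scaler0 addr0.
  by rewrite rjoin_idPl//; exact: rle_refl.
have -> : ppt_trunc n.+1 = ppt_trunc n \+ (fun u => tF (ell_unit p1 n) (J n u)).
  by apply/funext => u; rewrite ppt_truncS.
apply: riesz_hom_disjointD => //.
  have h := ppt_unit_riesz_hom n.
  split=> [a x y|x y]; first by rewrite (J_hom n).1 h.1.
  by rewrite (J_hom n).2 h.2.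
move=> x y x0 y0; rewrite rmeetC; apply: rmeet_disjoint_sum.
- by apply: ppt_ge0; [exact: ell_unit_ge0|exact: riesz_hom_ge0].
- by move=> i _; apply: ppt_ge0; [exact: ell_unit_ge0|exact: riesz_hom_ge0].
- move=> i _; apply: ppt_unit_disjoint; last 2 first.
  + exact: riesz_hom_ge0.
  + exact: riesz_hom_ge0.
  by rewrite gtn_eqF.
Qed.

Lemma ppt_trunc_tensor n t x :
  ppt_trunc n (tF t x) = tF (\sum_(i < n) t i *: ell_unit p1 i) x.
Proof.
rewrite bilinear_suml//; apply: eq_bigr => i _.
by rewrite J_tensor bilinearZr// bilinearZl.
Qed.

(** On an elementary tensor the truncation acts on the sequence only, and does not increase its
    norm. *)
Lemma ppt_trunc_norm_le n u : `|ppt_trunc n u| <= `|u|.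
Proof.
apply: (ppt_riesz_hom_contraction hF (ppt_trunc_riesz_hom n)
  (C := \sum_(i < n) `|ell_unit p1 i|)).
- by apply: sumr_ge0.
- move=> v; apply: (le_trans (ler_norm_sum _ _ _)); rewrite mulr_suml.
  apply: ler_sum => i _; apply: (le_trans (ppt_unit_norm_le _ _)).
  by rewrite ler_wpM2l.
- move=> t x t0 x0; rewrite ppt_trunc_tensor.
  apply: (le_trans (ppt_norm_le hF _ x0)); last by rewrite ler_wpM2r// ell_trunc_norm_le.
  by move=> k; rewrite ell_trunc_coord; case: ifP => // _; exact: t0.
Qed.

Lemma ppt_trunc_unit n i x : (i < n)%N ->
  ppt_trunc n (tF (ell_unit p1 i) x) = tF (ell_unit p1 i) x.
Proof.
move=> i_n; rewrite ppt_trunc_tensor; congr tF; apply/val_inj/funext => k.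
rewrite [LHS](ell_trunc_coord (ell_unit p1 i) n k); case: ltnP => // nk.
have -> : val (ell_unit p1 i) k = (k == i)%:R by [].
by rewrite gtn_eqF// (leq_trans i_n).
Qed.

End coordinates.

(** * Tensors of large projective norm *)

Section projective_approximation.
Context (R : realType) (X Y : normedModType R) (P : completeNormedModType R).
Context (tP : X -> Y -> P).
Hypothesis hP : is_projective_tensor tP.

(** The cost exceeds the norm of [v] by at most one half for moving into the algebraic tensor
    product and one half for a nearly optimal representation there. *)
Lemma projective_approx (Z : normedModType R) (A : {linear P -> Z}) (v : P) (e : R) :
  continuous A -> 0 < e ->
  exists (n : nat) (x : 'I_n -> X) (y : 'I_n -> Y),
    \sum_i `|x i| * `|y i| <= `|v| + 1 /\ `|A v - \sum_i A (tP (x i) (y i))| < e.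
Proof.
move=> cA e0; have [T [t [j [_ [lj ij] jE dj tE]]]] := hP.
have : nbhs v [set w | `|A v - A w| < e] by have /cvgrPdist_lt := cA v; apply.
move=> /(@nbhs_ballP R P)[d /= d0 hd].
have m0 : 0 < Num.min d (1 / 2) by rewrite lt_min d0 divr_gt0.
have [g vg] := dense_approx v dj m0; rewrite lt_min in vg.
case/andP: vg => vgd vg2.
have jg : `|j g| <= `|v| + 1 / 2.
  rewrite -(subKr v (j g)); apply: (le_trans (ler_normB _ _)).
  by rewrite lerD2l ltW.
have [jl jlE] := linear_packed lj.
have hinf : has_inf [set r : R | exists (n : nat) (x : 'I_n -> X) (y : 'I_n -> Y),
    g = \sum_i t (x i) (y i) /\ r = \sum_i `|x i| * `|y i|].
  split; last by exists 0 => _ [n [x [y [_ ->]]]]; apply: sumr_ge0.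
  (* Were there no representation, the infimum of the empty set being 0 would force [g = 0], which
     the empty sum represents. *)
  apply: contrapT => A0.
  have g0 : g = 0.
    apply: ij; rewrite [in RHS]jlE linear0; apply/normr0_eq0.
    rewrite jE /projective_norm [X in inf X](_ : _ = set0) ?inf0//.
    by apply: contrapT => /eqP/set0P.
  apply: A0; exists 0, 0%N, (fun=> 0), (fun=> 0).
  by rewrite !big_ord0.
have h2 : (0 : R) < 1 / 2 by rewrite divr_gt0.
have [_ [n [x [y [gE ->]]]]] := inf_adherent h2 hinf.
rewrite -[inf _]/(projective_norm t g) -jE => lt.
exists n, x, y; split.
  by apply: (le_trans (ltW lt)); lra.
rewrite -linear_sum.
have -> : \sum_i tP (x i) (y i) = j g.
  by rewrite gE jlE linear_sum; apply: eq_bigr => i _; rewrite tE jlE.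
by apply: hd; rewrite -ball_normE.
Qed.

End projective_approximation.

Section hard_blocks.
Context (R : realType) (p : R) (hp : 1 < p) (E F : banachLatticeType R).
Local Notation ellp := (ell (ltW hp)).
Local Notation unit := (ell_unit (ltW hp)).
Context (tF : ellp -> E -> F).
Hypothesis hF : is_positive_projective_tensor tF.
Hypothesis nAL :
  ~ exists L : banachLatticeType R, AL_space L /\ lattice_isomorphic E L.
Context (J : nat -> F -> E).
Hypotheses (J_hom : forall i, riesz_hom (J i)) (J_norm : forall i u, `|J i u| <= `|u|).
Hypothesis J_tensor : forall i t x, J i (tF t x) = t i *: x.

(** Costs are measured as in the projective norm, distances in [F]: up to closure, this is the image
    of a projective ball of radius [D]. *)
Definition tensor_approximable (D : R) (z : F) : Prop :=
  forall e, 0 < e -> exists (m : nat) (a : 'I_m -> ellp) (y : 'I_m -> E),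
    \sum_k `|a k| * `|y k| <= D /\ `|z - \sum_k tF (a k) (y k)| < e.

(* [W] is [2^-1 * m^(-1/p) * \sum_l (1 + r_l) (x) x_l], where the [r_l] are the *)
(* Rademacher functions on the [m] sign vectors and [x] is a nearly extremal    *)
(* disjoint family of large lower 1-estimate constant.                          *)
Lemma hard_block (j : nat) : exists (n : nat) (W : sign_vector n -> E),
  [/\ forall w, 0 <=r W w,
    forall iota : sign_vector n -> nat, injective iota ->
      `|\sum_w tF (unit (iota w)) (W w)| <= 1
  & forall iota : sign_vector n -> nat, injective iota ->
      forall (z : F) (gamma D : R), 0 <= D ->
      (forall w, J (iota w) z = gamma *: W w) -> tensor_approximable D z ->
      `|gamma| * 4 ^+ j <= 10 * D + 2].
Proof.
have p0 : 0 < p by exact: lt_trans hp.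
pose delta : R := (4 ^+ j)^-1.
have pow4 : 0 < 4 ^+ j :> R by rewrite exprn_gt0.
have d0 : 0 < delta by rewrite invr_gt0.
(* [N] depends on [delta] but not on the number of signs, so it is available before the family,
   whose constant [K] has to beat it, is chosen. The threshold [delta / 2] compensates the factor 2
   in [rho]. *)
have [N N0 hN] := rademacher_large_coefs_scaled hp (divr_gt0 d0 (ltr0Sn R 1)).
have [n [x [K [[K8 K0] dx x1 xK hK]]]] := near_extremal_family nAL (8 ^+ j * (N + 1)).
set m : R := #|{: sign_vector n}|%:R.
have m0 : 0 < m by exact: card_sign_vector_gt0.
pose s := m `^ p^-1.
have s0 : 0 < s by rewrite powR_gt0.
have sp : s `^ p = m by rewrite -powRrM mulVf ?gt_eqF// powRr1// ltW.
pose W (w : sign_vector n) : E := \sum_(l < n) (s^-1 * ((1 + rademacher R l w) / 2)) *: x l.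
have coef01 (l : 'I_n) w : 0 <= (1 + rademacher R l w) / 2 <= 1.
  have := lexx `|rademacher R l w|; rewrite {2}rademacher_norm ler_norml => /andP[h1 h2].
  by apply/andP; split; lra.
have x0 (l : 'I_n) : 0 <=r x l by exact: dx.1.
have W0 w : 0 <=r W w.
  apply: rsum_ge0 => l _; apply: rscaler_ge0 => //.
  by rewrite mulr_ge0 ?invr_ge0 ?(ltW s0)//; have /andP[] := coef01 l w.
have Wle w : W w <=r s^-1 *: \sum_(l < n) x l.
  rewrite scaler_sumr; apply: rler_sum => l _; apply: rler_scale_le => //.
  by rewrite ler_piMr ?invr_ge0 ?(ltW s0)//; have /andP[] := coef01 l w.
have [[tbl tbr] _ tpr] := ppt_bimorphism hF.
exists n, W; split=> // [iota inj|iota inj z gamma D D0 zW app].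
  have pos i y : 0 <=r y -> 0 <=r tF (unit i) y.
    by move=> y0; apply: (ppt_ge0 hF) => //; exact: ell_unit_ge0.
  apply: (@le_trans _ _ `|tF (\sum_w unit (iota w)) (s^-1 *: \sum_(l < n) x l)|).
    apply: ler_norm_pos; first by apply: rsum_ge0 => w _; exact: pos.
    rewrite (bilinear_suml (conj tbl tbr)); apply: rler_sum => w _.
    by apply: riesz_hom_le; [exact: (ppt_unit_riesz_hom hF)|exact: Wle].
  apply: (le_trans (ppt_norm_le hF _ _)).
  - by apply: rsum_ge0 => w _; exact: ell_unit_ge0.
  - by apply: rscaler_ge0; [rewrite invr_ge0 ltW|exact: rsum_ge0].
  rewrite normrZ ger0_norm ?invr_ge0 ?(ltW s0)// mulrA.
  apply: mulr_ile1 => //; first by apply: mulr_ge0 => //; rewrite invr_ge0 ltW.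
  by rewrite ler_pdivrMr// mul1r; exact: ell_norm_units_le.
have sm0 : 0 <= 2 * s / m by rewrite divr_ge0 ?(ltW m0)// mulr_ge0 ?(ltW s0).
(* By orthogonality of the Rademacher functions, averaging [W] against [rho l] recovers [x l]. *)
pose rho (l : 'I_n) (w : sign_vector n) : R := 2 * s / m * rademacher R l w.
have rho_norm l w : `|rho l w| = 2 * s / m.
  by rewrite normrM rademacher_norm mulr1 ger0_norm.
have rhoW (l : 'I_n) : \sum_w rho l w *: W w = x l.
  rewrite /W; under eq_bigr do rewrite scaler_sumr.
  rewrite exchange_big/=.
  under eq_bigr do (under eq_bigr do rewrite scalerA; rewrite -scaler_suml).
  have coef (i : 'I_n) :
      \sum_w rho l w * (s^-1 * ((1 + rademacher R i w) / 2)) = (l == i)%:R.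
    transitivity (m^-1 * \sum_w (rademacher R l w + rademacher R l w * rademacher R i w)).
      rewrite mulr_sumr; apply: eq_bigr => w _; rewrite /rho.
      by field; rewrite !gt_eqF.
    rewrite big_split/= sum_rademacher add0r sum_rademacherM mulrC mulfK//.
    by rewrite gt_eqF.
  rewrite (bigD1 l)//= coef eqxx scale1r big1 ?addr0// => i il.
  by rewrite coef eq_sym (negbTE il) scale0r.
(* Each of the [n] errors is at most [2 * s * eta], so together they stay below 1. *)
pose eta : R := (n%:R * (2 * s) + 1)^-1.
have ns0 : 0 <= n%:R * (2 * s) by rewrite mulr_ge0// mulr_ge0// ltW.
have eta0 : 0 < eta by rewrite invr_gt0 ltr_wpDl.
have [q [a [y [ayD zay]]]] := app _ eta0.
pose c (l : nat) (k : 'I_q) : R :=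
  if insub l is Some l' then \sum_w rho l' w * a k (iota w) else 0.
have cE (l : 'I_n) k : c l k = \sum_w rho l w * a k (iota w).
  by rewrite /c valK.
pose err (l : nat) : E := gamma *: x l - \sum_k c l k *: y k.
have errE (l : 'I_n) : err l = \sum_w rho l w *: J (iota w) (z - \sum_k tF (a k) (y k)).
  rewrite /err -(rhoW l) scaler_sumr.
  under [X in _ - X]eq_bigr do rewrite cE scaler_suml.
  rewrite exchange_big/= -sumrB; apply: eq_bigr => w _.
  rewrite (riesz_homB _ _ (J_hom _)) (riesz_hom_sum _ _ _ (J_hom _)) zW scalerBr; congr (_ - _).
    by rewrite !scalerA mulrC.
  rewrite scaler_sumr; apply: eq_bigr => k _.
  by rewrite J_tensor scalerA.
have err_le (l : 'I_n) : `|err l| <= 2 * s * eta.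
  rewrite errE; apply: (le_trans (ler_norm_sum _ _ _)).
  apply: (@le_trans _ _ (\sum_(w : sign_vector n) 2 * s / m * eta)).
    apply: ler_sum => w _; rewrite normrZ rho_norm ler_wpM2l//.
    by apply: (le_trans (J_norm _ _)); exact: ltW.
  rewrite sumr_const -[_ *+ #|_|]mulr_natr -/m.
  by rewrite (_ : 2 * s / m * eta * m = 2 * s * eta)//; field; rewrite gt_eqF.
have err1 : \sum_(l < n) `|err l| <= 1.
  apply: (le_trans (ler_sum _ (fun l _ => err_le l))).
  rewrite sumr_const card_ord -[_ *+ n]mulr_natl mulrA /eta ler_pdivrMr ?mul1r ?lerDl//.
  by rewrite ltr_wpDl.
have bound k : \sum_(w : sign_vector n) `|s * a k (iota w)| `^ p <= `|a k| `^ p * m.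
  under eq_bigr do rewrite normrM (gtr0_norm s0) powRM ?(ltW s0)// sp.
  by rewrite -mulr_sumr mulrC ler_wpM2r ?(ltW m0)// ell_sum_inj_le.
have cE' (l : 'I_n) k : `|c l k| = 2 / m * `|\sum_w rademacher R l w * (s * a k (iota w))|.
  have m2 : 0 <= 2 / m by rewrite divr_ge0// ltW.
  rewrite cE -{1}(ger0_norm m2) -normrM mulr_sumr; congr `|_|; apply: eq_bigr => w _.
  by rewrite /rho; field; rewrite gt_eqF.
have est : `|gamma| * \sum_(l < n) `|x l| <= 4 * N * D + \sum_(l < n) `|err l| + K * delta * D.
  apply: (@disjoint_combination_estimate _ _ _ _ _ _ _ (fun k => `|a k|) y c) => //.
  - exact: ltW.
  - move=> l k; have [_ /(_ l) h] := hN n _ _ (normr_ge0 (a k)) (bound k).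
    rewrite cE' mulrAC ler_pdivrMr//.
    apply: (le_trans (ler_wpM2l _ h)) => //.
    by rewrite -/m le_eqVlt; apply/orP; left; apply/eqP; ring.
  - move=> k; have [h _] := hN n _ _ (normr_ge0 (a k)) (bound k).
    apply: le_trans h; rewrite ler_nat subset_leq_card//.
    apply/fintype.subsetP => l; rewrite !inE cE' mulrAC ltr_pdivlMr// -/m => h.
    rewrite -(@ltr_pM2l _ 2)//; apply: le_lt_trans h.
    by rewrite le_eqVlt; apply/orP; left; apply/eqP; field.
  - by move=> l; rewrite /err addrC subrK.
have pow8 : 1 <= 8 ^+ j :> R by rewrite exprn_ege1// ler1n.
have K1 : 0 < K by apply: lt_le_trans K8; apply: mulr_gt0; [exact: exprn_gt0|rewrite ltr_wpDl].
have h48 : 4 ^+ j <= 8 ^+ j :> R by rewrite lerXn2r// ?nnegrE// ler_nat.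
have gK : `|gamma| * (K / 2) <= 4 * N * D + 1 + K * delta * D.
  apply: le_trans (le_trans (ler_wpM2l (normr_ge0 _) xK) est) _.
  by rewrite lerD2r lerD2l.
(* The choice of [K] absorbs [N]; the other term has [delta * 4 ^+ j = 1] and leaves [K * D].
   Dividing by [K / 2] gives [10 * D + 2]. *)
have NK : (4 * N * D + 1) * 4 ^+ j <= (4 * D + 1) * K.
  apply: (@le_trans _ _ ((4 * D + 1) * (8 ^+ j * (N + 1)))); last first.
    by rewrite ler_wpM2l// addr_ge0// mulr_ge0.
  rewrite (mulrC (8 ^+ j)) mulrA; apply: ler_pM => //.
  - by rewrite addr_ge0// !mulr_ge0.
  - have : 0 <= D * N by rewrite mulr_ge0.
    lra.
have := ler_wpM2r (ltW pow4) gK.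
have -> : (4 * N * D + 1 + K * delta * D) * 4 ^+ j = (4 * N * D + 1) * 4 ^+ j + K * D.
  by rewrite /delta; field; rewrite gt_eqF.
move=> fin; rewrite -(ler_pM2l K1).
have : K * (`|gamma| * 4 ^+ j) = 2 * (`|gamma| * (K / 2) * 4 ^+ j) by field.
move=> ->.
have : 0 <= K * D by rewrite mulr_ge0.
move: fin NK; set t1 := `|gamma| * (K / 2) * 4 ^+ j; set t2 := (4 * N * D + 1) * 4 ^+ j.
by lra.
Qed.

End hard_blocks.

(** * The sublattice *)

Section closed_lines.
Context (R : realType).

Lemma ler_invS_eq0 (a C : R) : 0 <= a -> (forall n : nat, a <= C / n.+1%:R) -> a = 0.
Proof.
move=> a0 h; apply/le_anti; rewrite a0 andbT.
by apply: (@ler_archimedean_div _ _ _ C) => m; rewrite add0r.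
Qed.

(** If some [w i0] is nonzero, the approximating scalars form a Cauchy sequence, as its multiples
    show; otherwise [z] vanishes. One scalar serves the whole family. *)
Lemma closed_line (I : Type) (Z : normedModType R) (w z : I -> Z) :
  (forall e : R, 0 < e -> exists c : R, forall i, `|z i - c *: w i| <= e) ->
  exists c : R, forall i, z i = c *: w i.
Proof.
move=> h; have /choice[c hc] : forall n : nat, exists c : R,
    forall i, `|z i - c *: w i| <= n.+1%:R^-1.
  by move=> n; apply: h; rewrite invr_gt0.
have [[i0 wi0]|w0] := pselect (exists i, w i != 0); last first.
  exists 0 => i; rewrite scale0r; apply/normr0_eq0.
  apply: (@ler_invS_eq0 _ 1) => // n; rewrite mul1r.
  have := hc n i; suff -> : w i = 0 by rewrite scaler0 subr0.
  by apply: contrapT => /eqP wi; apply: w0; exists i.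
have wp : 0 < `|w i0| by rewrite normr_gt0.
have [m n mn|e e0|l hl] := @rate_cvg R R^o c (fun m => 2 / `|w i0| / m.+1%:R).
- rewrite mulrAC ler_pdivlMr//.
  have -> : `|c m - c n| * `|w i0| = `|(c m - c n) *: w i0| by rewrite normrZ.
  have -> : (c m - c n) *: w i0 = (z i0 - c n *: w i0) - (z i0 - c m *: w i0).
    by rewrite scalerBl opprB addrCA addrAC subrr add0r.
  apply: (le_trans (ler_normB _ _)); rewrite mulr_natl mulr2n; apply: lerD => //.
  by apply: (le_trans (hc n i0)); rewrite lef_pV2 ?posrE// ler_nat.
- have e1 : 0 <= 2 / `|w i0| / e by rewrite !divr_ge0// ltW.
  exists (Num.bound (2 / `|w i0| / e)).
  rewrite ltr_pdivrMr// [e * _]mulrC -ltr_pdivrMr//; apply: (lt_trans (archi_boundP e1)).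
  by rewrite ltr_nat.
exists l => i; apply/subr0_eq/normr0_eq0.
apply: (@ler_invS_eq0 _ (1 + 2 / `|w i0| * `|w i|)) => // n.
apply: (le_trans (ler_distD (c n *: w i) _ _)); rewrite mulrDl mul1r; apply: lerD => //.
by rewrite -scalerBl normrZ mulrAC; apply: ler_wpM2r => //; exact: hl.
Qed.

Lemma closed_approx (Z : normedModType R) (S : set Z) :
  (forall x, (forall e, 0 < e -> exists y, S y /\ `|x - y| <= e) -> S x) -> closed S.
Proof.
move=> h x clx; apply: h => e e0; have [y [Sy xy]] := clx _ (nbhsx_ballx x e e0).
by exists y; split=> //; rewrite -ball_normE in xy; exact: ltW.
Qed.

Lemma independent_infinite_dimensional (V : lmodType R) (S : set V) (u : nat -> V) :
  (forall k, S (u k)) ->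
  (forall n (d : 'I_n -> R), \sum_k d k *: u k = 0 -> forall k, d k = 0) ->
  infinite_dimensional S.
Proof.
move=> Su ind [n [e he]].
have /choice[c hc] : forall k : nat, exists c : 'I_n -> R, u k = \sum_i c i *: e i.
  by move=> k; exact: he.
(* More rows than columns: a nonzero vector of the left kernel is a linear relation between the
   first [n.+1] vectors [u k]. *)
pose M : 'M[R]_(n.+1, n) := \matrix_(k, i) c k i.
have : kermx M != 0.
  by rewrite -mxrank_eq0 mxrank_ker subn_eq0 -ltnNge ltnS rank_leq_col.
case/rowV0Pn => v /sub_kermxP vM; case/negP; apply/eqP/rowP => k; rewrite mxE.
apply: (ind n.+1 (fun k => v 0 k)).
under eq_bigr do rewrite hc scaler_sumr.
rewrite exchange_big/= big1// => i _.
under eq_bigr do rewrite scalerA; rewrite -scaler_suml.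
have := congr1 (fun A : 'rV[R]_n => A 0 i) vM; rewrite !mxE => vMi.
rewrite (_ : \sum_k _ = 0) ?scale0r// -[RHS]vMi.
by apply: eq_bigr => l _; rewrite mxE.
Qed.

End closed_lines.

Section main_construction.
Context (R : realType) (p : R) (hp : 1 < p) (E F : banachLatticeType R).
Local Notation ellp := (ell (ltW hp)).
Local Notation unit := (ell_unit (ltW hp)).
Context (tF : ellp -> E -> F).
Hypothesis hF : is_positive_projective_tensor tF.
Context (J : nat -> F -> E).
Hypotheses (J_hom : forall i, riesz_hom (J i)) (J_norm : forall i u, `|J i u| <= `|u|).
Hypothesis J_tensor : forall i t x, J i (tF t x) = t i *: x.
Local Notation Q := (ppt_trunc tF J).

(** Convergence of the truncations to [x]. It is imposed on the sublattice so that its elements are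
    determined by their coordinates ([block_sublattice_eq0]); being stable under limits, it does not
    spoil closedness. *)
Definition finitely_exhausted (x : F) : Prop :=
  forall e : R, 0 < e -> exists N, forall n, (N <= n)%N -> `|x - Q n x| <= e.

Lemma finitely_exhausted_closed x :
  (forall e : R, 0 < e -> exists y, finitely_exhausted y /\ `|x - y| <= e) ->
  finitely_exhausted x.
Proof.
move=> h e e0; have e30 : 0 < e / 3 by rewrite divr_gt0.
have [y [hy xy]] := h _ e30; have [N hN] := hy _ e30.
exists N => n Nn; have yQ := hN n Nn.
have QQ := ppt_trunc_norm_le hF J_hom J_norm J_tensor n (y - x).
rewrite (riesz_homB _ _ (ppt_trunc_riesz_hom hF J_hom n)) in QQ.
have h1 := ler_distD y x (Q n x).
have h2 := ler_distD (Q n y) y (Q n x).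
by move: xy yQ QQ h1 h2; rewrite (distrC y x); lra.
Qed.

Lemma finitely_exhausted_finite x N :
  (forall n, (N <= n)%N -> Q n x = x) -> finitely_exhausted x.
Proof. by move=> h e e0; exists N => n /h ->; rewrite subrr normr0 ltW. Qed.

Lemma finitely_exhausted_sublattice : riesz_subspace finitely_exhausted.
Proof.
have hQ := ppt_trunc_riesz_hom hF J_hom.
have fe_lin (a : R) x y : finitely_exhausted x -> finitely_exhausted y ->
    finitely_exhausted (a *: x + y).
  move=> hx hy e e0; have a1 : 0 < `|a| + 1 by rewrite ltr_wpDl.
  have [N hN] := hx (e / 2 / (`|a| + 1)) (divr_gt0 (divr_gt0 e0 (ltr0Sn _ 1)) a1).
  have [N' hN'] := hy (e / 2) (divr_gt0 e0 (ltr0Sn _ 1)).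
  exists (maxn N N') => n; rewrite geq_max => /andP[Nn Nn'].
  rewrite (hQ n).1 opprD addrACA -scalerBr; apply: (le_trans (ler_normD _ _)).
  rewrite normrZ [leRHS]splitr; apply: lerD; last exact: hN'.
  have := hN _ Nn; rewrite ler_pdivlMr//; apply: le_trans.
  by rewrite mulrC ler_wpM2l// lerDl.
have fe_join x y : finitely_exhausted x -> finitely_exhausted y ->
    finitely_exhausted (rjoin x y).
  move=> hx hy e e0; have [N hN] := hx (e / 2) (divr_gt0 e0 (ltr0Sn _ 1)).
  have [N' hN'] := hy (e / 2) (divr_gt0 e0 (ltr0Sn _ 1)).
  exists (maxn N N') => n; rewrite geq_max => /andP[Nn Nn'].
  rewrite (hQ n).2; apply: (le_trans (norm_rjoinB _ _ _ _)).
  by rewrite [leRHS]splitr; apply: lerD; [exact: hN|exact: hN'].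
have zero : finitely_exhausted 0.
  by apply: (@finitely_exhausted_finite _ 0%N) => n _; rewrite riesz_hom0.
have fe_opp x : finitely_exhausted x -> finitely_exhausted (- x).
  by move=> hx; rewrite -[- x]addr0 -scaleN1r; exact: fe_lin.
split; first by split.
move=> x y hx hy; split; first exact: fe_join.
by rewrite /rmeet; apply: (fe_opp); apply: fe_join; exact: (fe_opp).
Qed.

Context (U : nat -> E) (kappa : nat -> nat).
Hypothesis U0 : forall i, 0 <=r U i.

Definition blockwise_proportional (x : F) : Prop :=
  exists c : nat -> R, forall i, J i x = c (kappa i) *: U i.

Definition block_sublattice : set F :=
  [set x | finitely_exhausted x /\ blockwise_proportional x].

Lemma block_sublattice_riesz : riesz_subspace block_sublattice.
Proof.
have [[z l] m] := finitely_exhausted_sublattice.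
split; first split.
- by split=> //; exists (fun=> 0) => i; rewrite riesz_hom0// scale0r.
- move=> a x y [hx [c hc]] [hy [d hd]]; split; first exact: l.
  exists (fun k => a * c k + d k) => i.
  by rewrite (J_hom i).1 hc hd scalerA scalerDl.
- move=> x y [hx [c hc]] [hy [d hd]]; have [hj hm] := m _ _ hx hy.
  split; split=> //.
    exists (fun k => Num.max (c k) (d k)) => i.
    by rewrite (J_hom i).2 hc hd rjoinZl.
  exists (fun k => - Num.max (- c k) (- d k)) => i.
  by rewrite riesz_hom_meet// hc hd /rmeet -!scaleNr rjoinZl// scaleNr.
Qed.

(** Proportionality is treated block by block, applying [closed_line] to the coordinates with a
    given value of [kappa]. *)
Lemma block_sublattice_closed : closed block_sublattice.
Proof.
apply: closed_approx => x hx; split.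
  by apply: finitely_exhausted_closed => e /hx[y [[hy _] xy]]; exists y.
have /choice[c hc] : forall k, exists c : R, forall i : {i | kappa i = k},
    J (sval i) x = c *: U (sval i).
  move=> k; apply: closed_line => e /hx[y [[_ [c hc]] xy]].
  exists (c k) => -[i /= <-]; rewrite -hc -riesz_homB//.
  exact: le_trans (J_norm _ _) xy.
by exists c => i; exact: (hc (kappa i) (exist _ i erefl)).
Qed.

Lemma block_sublattice_eq0 x : block_sublattice x -> (forall i, J i x = 0) -> x = 0.
Proof.
move=> [hx _] Jx; apply/normr0_eq0/le_anti; rewrite normr_ge0 andbT.
apply/ler_addgt0Pr => e e0; rewrite add0r; have [N hN] := hx _ e0.
have := hN N (leqnn N); rewrite /ppt_trunc big1 ?subr0// => i _.
by rewrite Jx (riesz_hom0 (ppt_unit_riesz_hom hF i)).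
Qed.

End main_construction.

Theorem corollary3p11 (R : realType) (E : banachLatticeType R)
  (hE : ~ exists L : banachLatticeType R, AL_space L /\ lattice_isomorphic E L)
  (p : R) (hp : 1 < p)
  (P : completeNormedModType R) (tP : ell (ltW hp) -> E -> P)
  (hP : is_projective_tensor tP)
  (F : banachLatticeType R) (tF : ell (ltW hp) -> E -> F)
  (hF : is_positive_projective_tensor tF)
  (A_L : {linear P -> F}) (A_L_bounded : continuous A_L)
  (A_L_tensor : forall (t : ell (ltW hp)) (x : E), A_L (tP t x) = tF t x) :
  completely_latticeable (~` range A_L).
Proof.
have [J [J_hom J_norm J_tensor]] := ppt_coordinates hF.
have /choice[B hB] : forall j, exists B : {n & sign_vector n -> E},
  [/\ forall w, 0 <=r projT2 B w,
    forall iota : sign_vector (projT1 B) -> nat, injective iota ->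
      `|\sum_w tF (ell_unit (ltW hp) (iota w)) (projT2 B w)| <= 1
  & forall iota : sign_vector (projT1 B) -> nat, injective iota ->
      forall (z : F) (gamma D : R), 0 <= D ->
      (forall w, J (iota w) z = gamma *: projT2 B w) -> tensor_approximable tF D z ->
      `|gamma| * 4 ^+ j <= 10 * D + 2].
  move=> j; have [n [W hW]] := hard_block hF hE J_hom J_norm J_tensor j.
  by exists (existT _ n W).
pose Om j := sign_vector (projT1 (B j)); pose W j : Om j -> E := projT2 (B j).
(* Copy [k] of pattern [j] gets its own coordinates. Since the type of [w] depends on [j], [w] is
   encoded separately. *)
pose iota (k j : nat) (w : Om j) : nat := pickle ((k, j), pickle w).
have iota_inj k j : injective (iota k j).
  move=> w w' /(pcan_inj (@pickleK (nat * nat * nat)%type)) [].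
  exact: (pcan_inj (@pickleK (Om j))).
pose U i : E := if (pickle_inv i : option (nat * nat * nat)) is Some (k, j, l) then
  if (pickle_inv l : option (Om j)) is Some w then 2 ^- j *: W j w else 0 else 0.
(* The default value is harmless, since [U i = 0] whenever it is taken. *)
pose kappa i : nat :=
  if (pickle_inv i : option (nat * nat * nat)) is Some (k, j, l) then k else 0%N.
have UE k j w : U (iota k j w) = 2 ^- j *: W j w.
  by rewrite /U /iota !pickleK_inv.
have kappaE k j w : kappa (iota k j w) = k by rewrite /kappa /iota pickleK_inv.
have Ucode i : (exists k j w, i = iota k j w) \/
    (U i = 0 /\ forall k j w, i <> iota k j w).
  have [|nc] := pselect (exists k j w, i = iota k j w); [by left|right].
  split; last by move=> k j w ik; apply: nc; exists k, j, w.
  rewrite /U; have := @pickle_invK (nat * nat * nat)%type i.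
  case: pickle_inv => [[[k j] l]|//] /= kjl.
  have := @pickle_invK (Om j) l; case: pickle_inv => [w|//] /= wl.
  by exfalso; apply: nc; exists k, j, w; rewrite -kjl -wl.
have W0 j w : 0 <=r W j w by have [h _ _] := hB j; exact: h.
have U0 i : 0 <=r U i.
  have [[k [j [w ->]]]|[-> _]] := Ucode i; last exact: rle_refl.
  by rewrite UE; apply: rscaler_ge0 => //; rewrite invr_ge0 exprn_ge0.
pose S := block_sublattice tF J U kappa.
pose blk k j : F := \sum_w tF (ell_unit (ltW hp) (iota k j w)) (W j w).
pose s k n : F := \sum_(j < n) 2 ^- j *: blk k j.
have nblk k j : `|blk k j| <= 1.
  by have [_ h _] := hB j; apply: h; exact: iota_inj.
have small (e : R) : 0 < e -> exists m, forall n, (m <= n)%N -> 2 * 2 ^- n <= e.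
  move=> e0; have e1 : 0 <= 2 / e by rewrite divr_ge0// ltW.
  exists (Num.bound (2 / e)) => n bn; rewrite ler_pdivrMr ?exprn_gt0// mulrC.
  rewrite -ler_pdivrMr//; apply: (le_trans (ltW (archi_boundP e1))).
  by rewrite -natrX ler_nat (leq_trans bn)// ltnW// ltn_expl.
have s_cauchy k m n : (m <= n)%N -> `|s k m - s k n| <= 2 * 2 ^- m.
  move=> /subnK <-; set d := (n - m)%N.
  (* The exact geometric sum, subtracted term included, is what the induction on [d] needs. *)
  apply: (@le_trans _ _ (2 * 2 ^- m - 2 * 2 ^- (d + m))); last first.
    by rewrite gerBl mulr_ge0// invr_ge0 exprn_ge0.
  elim: d => [|d IHd]; first by rewrite add0n !subrr normr0.
  have -> : s k (d.+1 + m)%N = s k (d + m)%N + 2 ^- (d + m) *: blk k (d + m)%N.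
    by rewrite /s addSn big_ord_recr.
  rewrite opprD addrA; apply: (le_trans (ler_normB _ _)).
  have pd : 0 <= 2 ^- (d + m) :> R by rewrite invr_ge0 exprn_ge0.
  have : `|2 ^- (d + m) *: blk k (d + m)%N| <= 2 ^- (d + m).
    by rewrite normrZ ger0_norm// ler_piMr.
  have -> : 2 * 2 ^- (d.+1 + m) = 2 ^- (d + m) :> R.
    by rewrite addSn exprS invfM mulrA divff ?mul1r.
  by move: IHd; lra.
have /choice[u hu] : forall k, exists l, forall m, `|s k m - l| <= 2 * 2 ^- m.
  move=> k; apply: (rate_cvg (@s_cauchy k)) => e e0.
  have [m hm] := small _ (divr_gt0 e0 (ltr0Sn R 1)).
  exists m; apply: (le_lt_trans (hm m (leqnn m))).
  by rewrite ltr_pdivrMr// ltr_pMr// ltr1n.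
have Js k i n : J i (s k n) = \sum_(j < n) 2 ^- j *: \sum_w (i == iota k j w)%:R *: W j w.
  rewrite riesz_hom_sum//; apply: eq_bigr => j _; rewrite riesz_homZ//.
  rewrite riesz_hom_sum//; congr (_ *: _); apply: eq_bigr => w _.
  by rewrite J_tensor.
have Ju k i : J i (u k) = (kappa i == k)%:R *: U i.
  suff [N hN] : exists N, forall n, (N <= n)%N -> J i (s k n) = (kappa i == k)%:R *: U i.
    apply/esym/subr0_eq/normr0_eq0/le_anti; rewrite normr_ge0 andbT.
    apply/ler_addgt0Pr => e e0; rewrite add0r; have [m hm] := small _ e0.
    rewrite -(hN (maxn N m)) ?leq_maxl// -riesz_homB//.
    by apply: (le_trans (J_norm _ _)); apply: (le_trans (hu _ _)); apply: hm; exact: leq_maxr.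
  have [[k' [j [w ->]]]|[-> nc]] := Ucode i; last first.
    exists 0%N => n _; rewrite Js scaler0 big1// => j _; rewrite big1 ?scaler0// => w _.
    by have /eqP/negbTE -> := nc k j w; rewrite scale0r.
  rewrite kappaE UE; exists j.+1 => n jn; rewrite Js.
  have neq j' (w' : Om j') : (k', j) != (k, j') -> iota k' j w == iota k j' w' = false.
    move=> kj; apply/negbTE; apply: contra kj => /eqP.
    by move=> /(pcan_inj (@pickleK (nat * nat * nat)%type)) h; apply/eqP; exact: (congr1 fst h).
  rewrite (bigD1 (Ordinal jn))//= [X in _ + X]big1 ?addr0; last first.
    move=> j' jj'; rewrite big1 ?scaler0// => w' _; rewrite neq ?scale0r//.
    by apply: contra jj' => /eqP[_ jj']; apply/eqP/val_inj; rewrite /= -jj'.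
  have [<-|kk'] := eqVneq k' k.
    rewrite scale1r; congr (_ *: _); rewrite (bigD1 w)//= eqxx scale1r big1 ?addr0// => w' ww'.
    by rewrite (inj_eq (iota_inj k' j)) eq_sym (negbTE ww') scale0r.
  rewrite scale0r big1 ?scaler0// => w' _; rewrite neq ?scale0r//.
  by apply: contra kk' => /eqP[->].
have Su k : S (u k).
  split; last by exists (fun l => (l == k)%:R).
  apply: (finitely_exhausted_closed hF J_hom J_norm J_tensor) => e e0.
  have [m hm] := small _ e0; exists (s k m); split; last first.
    by rewrite distrC; apply: (le_trans (hu _ _)); exact: hm.
  pose N := \max_(j < m) \max_w (iota k j w).+1.
  apply: (@finitely_exhausted_finite _ _ _ _ _ _ _ _ N) => n Nn.
  have hQ := ppt_trunc_riesz_hom hF J_hom n.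
  rewrite riesz_hom_sum//; apply: eq_bigr => j _; rewrite riesz_homZ//; congr (_ *: _).
  rewrite riesz_hom_sum//; apply: eq_bigr => w _.
  apply: (ppt_trunc_unit hF J_tensor); apply: leq_trans Nn.
  by apply: leq_trans (leq_bigmax j); exact: (leq_bigmax w).
have nonzero k : exists i, kappa i = k /\ U i != 0.
  have [w Ww] : exists w : Om 0%N, W 0%N w != 0.
    apply: contrapT => nW; have [_ _ h] := hB 0%N.
    (* If the pattern for [j = 0] vanished, the zero tensor would carry 3 times it at cost 0, and
       the lower bound would read [3 <= 2]. *)
    have : `|3| * 4 ^+ 0 <= 10 * 0 + 2 :> R.
      apply: (h _ (iota_inj 0%N 0%N) 0 3 0) => // [w|e e0].
        rewrite riesz_hom0//; suff -> : projT2 (B 0%N) w = 0 by rewrite scaler0.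
        by apply: contrapT => /eqP Ww; apply: nW; exists w.
      by exists 0%N, (fun=> 0), (fun=> 0); rewrite !big_ord0 subrr normr0.
    rewrite normr_nat; lra.
  exists (iota k 0%N w); split; first exact: kappaE.
  by rewrite UE expr0 invr1 scale1r.
exists S; split.
- exact: (block_sublattice_riesz hF).
- exact: (block_sublattice_closed hF).
- apply: (independent_infinite_dimensional Su) => n d du k.
  have [i [ik Ui]] := nonzero k.
  have := congr1 (J i) du; rewrite riesz_hom_sum// (riesz_hom0 (J_hom i)).
  rewrite (bigD1 k)//= big1 ?addr0; last first.
    move=> l lk; rewrite riesz_homZ// Ju ik; have -> : (k == l :> nat) = false.
      by apply/negbTE; apply: contra lk => /eqP kl; apply/eqP/val_inj.
    by rewrite scale0r scaler0.
  rewrite riesz_homZ// Ju ik eqxx scale1r => /eqP.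
  by rewrite scaler_eq0 (negbTE Ui) orbF => /eqP.
- move=> x Sx x0 [v _ vx]; case/eqP: x0.
  apply: (block_sublattice_eq0 hF Sx) => i.
  have [_ [c hc]] := Sx; rewrite hc.
  suff -> : c (kappa i) = 0 by rewrite scale0r.
  set k := kappa i; pose D := `|v| + 1.
  have D0 : 0 <= D by rewrite addr_ge0.
  have app : tensor_approximable tF D x.
    move=> e e0; have [n [a [y [aD vy]]]] := projective_approx hP v A_L_bounded e0.
    exists n, a, y; split=> //; rewrite -vx.
    by under eq_bigr do rewrite -A_L_tensor.
  (* On pattern [j] the multiple is [c k * 2 ^- j], against a factor [4 ^+ j] in the cost. As [j] is
     arbitrary and [D] fixed, [c k] has to vanish. *)
  have ck j : `|c k| * 2 ^+ j <= 10 * D + 2.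
    have [_ _ h] := hB j.
    have gW w : J (iota k j w) x = (c k * 2 ^- j) *: W j w.
      by rewrite hc kappaE UE scalerA.
    have := h _ (iota_inj k j) x _ D D0 gW app; apply: le_trans.
    rewrite normrM -mulrA; apply: ler_wpM2l => //.
    rewrite ger0_norm ?invr_ge0 ?exprn_ge0// ler_pdivlMl ?exprn_gt0//.
    by rewrite -exprMn -natrM.
  have DD : 0 <= 10 * D + 2 by rewrite addr_ge0// mulr_ge0.
  apply/normr0_eq0; apply: (@ler_invS_eq0 _ _ (10 * D + 2)) => // n.
  rewrite ler_pdivlMr//; apply: le_trans (ck n); apply: ler_wpM2l => //.
  by rewrite -natrX ler_nat ltn_expl.
Qed.
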